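(* Suppose that each gradient $\nabla f_i$ is $\sigma_i$-strongly monotone for some $\sigma_i>0$ and Lipschitz with some constant $L_i>0$; that $\Omega\subseteq\mathbb R^p$ is convex and compact with nonempty interior; and that the surface $\partial\Omega$ has bounded normal curvature. Consider the distributed optimization algorithm $$\dot\eta_i=\beta k_1\sum_{j=1}^Na_{ij}(\eta_j-\eta_i)+\beta s_i-\beta\eta_i-\beta\alpha z_i,$$ $$\dot z_i=\frac{k_2}{\beta}\sum_{j=1}^Na_{ij}(z_j-z_i)+\frac{d\nabla f_i(s_i)}{dt},$$ $$s_i=P_\Omega(\eta_i),\qquad i=1,\dots,N,$$ with $z_i(0)=\nabla f_i(s_i(0))$. Then the parameters $k_1,k_2,\alpha,\beta>0$ can be selected such that, for every $i$, $s_i(t)$ converges exponentially to $y^*$, the solution of $\min_{y\in\Omega}\sum_{i=1}^Nf_i(y)$; that is, there are constants $C\geq 0,\rho>0$ with $\|s_i(t)-y^*\|\le Ce^{-\rho t}$ for all $t\ge0$.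
   Context: $\mathcal G$ is an undirected connected graph on $\{1,\dots,N\}$ with adjacency entries $a_{ij}=1$ if $i$ and $j$ are joined by an edge and $a_{ij}=0$ otherwise. $f_i:\Omega\to\mathbb R$ is the local objective of agent $i$. $\eta_i,z_i,s_i$ take values in $\mathbb R^p$. $\sigma_i$-strongly monotone means $\langle\nabla f_i(x)-\nabla f_i(y),x-y\rangle\ge\sigma_i\|x-y\|^2$. $P_\Omega(x)=\operatorname{argmin}_{v\in\Omega}\|v-x\|^2$. The term $d\nabla f_i(s_i)/dt$ is the time derivative along the trajectory. *)

(* Defs.v *)
From mathcomp Require Import all_boot all_order all_algebra.
From mathcomp Require Import all_classical all_reals all_analysis.
Set Implicit Arguments.
Unset Strict Implicit.
Unset Printing Implicit Defensive.
Import Order.TTheory GRing.Theory Num.Theory.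
Import numFieldNormedType.Exports.
Local Open Scope classical_set_scope.
Local Open Scope ring_scope.

(* The library norm on 'rV[R]_p is the sup norm: it induces the usual topology
   and derivatives, but the Euclidean structure has to be introduced. *)
Definition dot (R : realType) (p : nat) (u v : 'rV[R]_p) : R :=
  \sum_(i < p) u ord0 i * v ord0 i.

Definition enorm (R : realType) (p : nat) (u : 'rV[R]_p) : R :=
  Num.sqrt (dot u u).

Definition is_argmin (R : realType) (T : Type) (A : set T) (F : T -> R)
    (y : T) : Prop :=
  A y /\ forall v, A v -> F y <= F v.

Definition proj (R : realType) (p : nat) (Omega : set 'rV[R]_p)
    (x : 'rV[R]_p) : 'rV[R]_p :=
  get [set y | is_argmin Omega (fun v => enorm (v - x) ^+ 2) y].

(* [f] stands for a function defined on [Omega] only (its values elsewhere are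
   never used), so differentiability is relative to [Omega].  When [Omega] is
   convex with nonempty interior this determines [g] on all of [Omega],
   boundary included. *)
Definition is_gradient_on (R : realType) (p : nat) (Omega : set 'rV[R]_p)
    (f : 'rV[R]_p -> R) (g : 'rV[R]_p -> 'rV[R]_p) : Prop :=
  forall x, Omega x -> forall eps : R, 0 < eps ->
    \forall y \near within Omega (nbhs x),
      `|f y - f x - dot (g x) (y - x)| <= eps * enorm (y - x).

Definition strongly_monotone_on (R : realType) (p : nat)
    (Omega : set 'rV[R]_p) (sigma : R) (g : 'rV[R]_p -> 'rV[R]_p) : Prop :=
  forall x y, Omega x -> Omega y ->
    sigma * enorm (x - y) ^+ 2 <= dot (g x - g y) (x - y).

Definition elipschitz_on (R : realType) (p : nat) (Omega : set 'rV[R]_p)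
    (L : R) (g : 'rV[R]_p -> 'rV[R]_p) : Prop :=
  forall x y, Omega x -> Omega y -> enorm (g x - g y) <= L * enorm (x - y).

Definition boundary (T : topologicalType) (A : set T) : set T :=
  closure A `\` interior A.

Definition C2_on (R : realType) (p : nat) (U : set 'rV[R]_p)
    (g : 'rV[R]_p -> R) : Prop :=
  forall y, U y ->
    {for y, continuous g} /\
    forall v : 'rV[R]_p,
      [/\ derivable g y v, {for y, continuous ('D_v g)} &
      forall w : 'rV[R]_p,
        derivable ('D_v g) y w /\ {for y, continuous ('D_w ('D_v g))}].

(* Normal curvature presupposes a hypersurface of class C^2: locally, a regular
   level set of a C^2 function. *)
Definition C2_surface (R : realType) (p : nat) (S : set 'rV[R]_p) : Prop :=
  forall x, S x -> exists (U : set 'rV[R]_p) (g : 'rV[R]_p -> R),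
    [/\ open U, U x, C2_on U g,
        forall y, U y -> (S y <-> g y = 0) &
        forall y, U y -> S y -> exists v, 'D_v g y != 0].

(* [c] is, near parameter 0, a C^2 curve lying on [S], parametrized by arc
   length, with c(0) = x. *)
Definition arclength_curve (R : realType) (p : nat) (S : set 'rV[R]_p)
    (x : 'rV[R]_p) (c : R -> 'rV[R]_p) : Prop :=
  c 0 = x /\
  \forall t \near (0 : R),
    [/\ S (c t), derivable c t 1, derivable (derive1 c) t 1,
        {for t, continuous (derive1 (derive1 c))} & enorm (derive1 c t) = 1].

Definition unit_normal (R : realType) (p : nat) (S : set 'rV[R]_p)
    (x n : 'rV[R]_p) : Prop :=
  enorm n = 1 /\ forall c, arclength_curve S x c -> dot n (derive1 c 0) = 0.

(* [k] is the normal curvature at [x], with respect to the unit normal [n], in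
   the direction of the velocity of some curve on [S]: the component along [n]
   of the curvature vector of that curve. *)
Definition normal_curvature (R : realType) (p : nat) (S : set 'rV[R]_p)
    (x n : 'rV[R]_p) (k : R) : Prop :=
  exists2 c, arclength_curve S x c & k = dot n (derive1 (derive1 c) 0).

Definition bounded_normal_curvature (R : realType) (p : nat)
    (S : set 'rV[R]_p) : Prop :=
  C2_surface S /\
  exists K : R, forall x n k, S x -> unit_normal S x n ->
    normal_curvature S x n k -> `|k| <= K.

Definition abs_continuous (R : realType) (p : nat) (a b : R)
    (h : R -> 'rV[R]_p) : Prop :=
  forall eps : R, 0 < eps -> exists2 delta : R, 0 < delta &
    forall (n : nat) (l r : 'I_n -> R),
      (forall k, [/\ a <= l k, l k <= r k & r k <= b]) ->
      trivIset [set: 'I_n] (fun k => `]l k, r k[%classic) ->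
      \sum_(k < n) (r k - l k) < delta ->
      \sum_(k < n) enorm (h (r k) - h (l k)) < eps.

Definition adj (R : realType) (N : nat) (e : rel 'I_N) (i j : 'I_N) : R :=
  (e i j)%:R.

(* Solutions are taken in the sense of Caratheodory (locally absolutely
   continuous, equations holding almost everywhere): the projection is not
   differentiable everywhere, hence in general neither is t |-> gradf i (s i t),
   whose derivative enters the second equation.  Only times t >= 0 matter. *)
Definition trajectory (R : realType) (N p : nat) (e : rel 'I_N)
    (Omega : set 'rV[R]_p) (gradf : 'I_N -> 'rV[R]_p -> 'rV[R]_p)
    (k1 k2 alpha beta : R) (eta z s : 'I_N -> R -> 'rV[R]_p) : Prop :=
  [/\ forall i t, 0 <= t -> s i t = proj Omega (eta i t),
      forall i, z i 0 = gradf i (s i 0),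
      forall i T, 0 < T ->
        abs_continuous 0 T (eta i) /\ abs_continuous 0 T (z i) &
      {ae @lebesgue_measure R, forall t : R, 0 < t -> forall i,
        is_derive t 1 (eta i)
          ((beta * k1) *: (\sum_(j < N) adj R e i j *: (eta j t - eta i t))
           + beta *: s i t - beta *: eta i t - (beta * alpha) *: z i t) /\
        (derivable (fun u => gradf i (s i u)) t 1 /\
         is_derive t 1 (z i)
          ((k2 / beta) *: (\sum_(j < N) adj R e i j *: (z j t - z i t))
           + 'D_1 (fun u => gradf i (s i u)) t))}].

(* Main.v *)
Require Import Defs.
From mathcomp Require Import all_boot all_order all_algebra.
From mathcomp Require Import all_classical all_reals all_analysis.
From mathcomp Require Import ring lra.
Set Implicit Arguments.
Unset Strict Implicit.
Unset Printing Implicit Defensive.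
Import Order.TTheory GRing.Theory Num.Theory.
Import numFieldNormedType.Exports.
Local Open Scope classical_set_scope.
Local Open Scope ring_scope.

(** Take alpha = beta = 1. With s* the minimizer, z* the mean of the gradients at
    s* and eta* = s* - z*, the function
      Phi = M * sum_i V(eta_i) + 1/2 sum_i |eta_i - eta*|^2
              + 1/2 sum_i |z_i - mean z|^2,
      V(x) = 1/2 (|x - s*|^2 - |x - P x|^2),
    satisfies Phi' <= - rho Phi almost everywhere for k1 and then k2 large. The
    potential V is convex with gradient P x - s*, hence yields a term
    - sigma |s - s*|^2; the coupling of the eta_i helps because P is firmly
    nonexpansive. Since V vanishes on the normal cone at s*, the quadratic terms in
    eta are needed to absorb the derivative of the gradients that drives the
    consensus error of z. The mean of the z_i always equals the mean of the gradients.
    As Phi is locally absolutely continuous it decays exponentially, and it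
    dominates M/2 |s_i - s*|^2. *)

(** * Euclidean structure *)

(** For alpha = beta = 1 an equilibrium with consensus in eta and z satisfies s* - eta* - z* = 0,
    which is where eta* comes from. Minimality of s* says that -z* = eta* - s* lies in the normal
    cone of Omega at s*, so that P eta* = s*. The main obstacle is the forcing term of z: it is the
    derivative of the gradient along s = P eta, and P need not be differentiable. No chain rule is
    applied to it. Since P is nonexpansive and the gradients are Lipschitz, the increments of the
    gradients are at most L times those of eta; wherever both derivatives exist, this bound passes
    to them. The derivative of eta is in turn bounded by the error terms, with a factor that grows
    with k1 but does not involve k2. Hence the order of the choices: k1 dominates the disagreement
    of the s_i through a Poincare inequality on the graph, a Young weight c then offsets the factor
    depending on k1, and k2 is fixed last to pay for 1/c. The second obstacle is that the equations
    hold only almost everywhere, so that every integration step goes through a monotonicity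
    criterion for absolutely continuous functions. *)

Section Euclidean.
Variables (R : realType) (p : nat).
Implicit Types (u v w x y : 'rV[R]_p) (a : R).

Lemma dotC u v : dot u v = dot v u.
Proof. by rewrite /dot; apply: eq_bigr => i _; rewrite mulrC. Qed.

Lemma dotDl u v w : dot (u + v) w = dot u w + dot v w.
Proof. by rewrite -big_split; apply: eq_bigr => i _; rewrite mxE mulrDl. Qed.

Lemma dotZl a u v : dot (a *: u) v = a * dot u v.
Proof. by rewrite /dot mulr_sumr; apply: eq_bigr => i _; rewrite mxE mulrA. Qed.

Lemma dotDr u v w : dot w (u + v) = dot w u + dot w v.
Proof. by rewrite dotC dotDl !(dotC w). Qed.

Lemma dotZr a u v : dot u (a *: v) = a * dot u v.
Proof. by rewrite dotC dotZl dotC. Qed.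

Lemma dotNl u v : dot (- u) v = - dot u v.
Proof. by rewrite -scaleN1r dotZl mulN1r. Qed.

Lemma dotNr u v : dot u (- v) = - dot u v.
Proof. by rewrite dotC dotNl dotC. Qed.

Lemma dot0l u : dot 0 u = 0.
Proof. by rewrite -(scale0r 0) dotZl mul0r. Qed.

Lemma dot0r u : dot u 0 = 0.
Proof. by rewrite dotC dot0l. Qed.

Lemma dot_suml (I : Type) (r : seq I) (P : pred I) (F : I -> 'rV[R]_p) u :
  dot (\sum_(i <- r | P i) F i) u = \sum_(i <- r | P i) dot (F i) u.
Proof.
exact: (big_morph (fun x => dot x u) (fun x y => dotDl x y u) (dot0l u)).
Qed.

Lemma dot_sumr (I : Type) (r : seq I) (P : pred I) (F : I -> 'rV[R]_p) u :
  dot u (\sum_(i <- r | P i) F i) = \sum_(i <- r | P i) dot u (F i).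
Proof. by rewrite dotC dot_suml; apply: eq_bigr => i _; rewrite dotC. Qed.

Definition dotE := (dotDl, dotDr, dotNl, dotNr, dotZl, dotZr).

Lemma dot_ge0 u : 0 <= dot u u.
Proof. by apply: sumr_ge0 => i _; rewrite -expr2 sqr_ge0. Qed.

Lemma dot_eq0 u : dot u u = 0 -> u = 0.
Proof.
move=> /eqP; rewrite psumr_eq0 => [/allP u0|i _]; last first.
  by rewrite -expr2 sqr_ge0.
apply/rowP => i; have /implyP/(_ isT) := u0 i (mem_index_enum _).
by rewrite mulf_eq0 orbb mxE => /eqP.
Qed.

Lemma enorm_ge0 u : 0 <= enorm u.
Proof. exact: sqrtr_ge0. Qed.

Lemma sqr_enorm u : enorm u ^+ 2 = dot u u.
Proof. by rewrite sqr_sqrtr// dot_ge0. Qed.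

Lemma enormN u : enorm (- u) = enorm u.
Proof. by rewrite /enorm !dotE opprK. Qed.

Lemma enormBC u v : enorm (u - v) = enorm (v - u).
Proof. by rewrite -enormN opprB. Qed.

Lemma enormZ a u : enorm (a *: u) = `|a| * enorm u.
Proof. by rewrite /enorm !dotE mulrA -expr2 sqrtrM ?sqr_ge0// sqrtr_sqr. Qed.

Lemma enorm0_eq0 u : enorm u <= 0 -> u = 0.
Proof.
move=> u0; apply: dot_eq0; rewrite -sqr_enorm.
by have /eqP -> : enorm u == 0; [rewrite eq_le u0 enorm_ge0 | rewrite expr0n].
Qed.

Lemma dot_young a u v : 0 < a -> 2 * dot u v <= a * dot u u + a^-1 * dot v v.
Proof.
move=> a0; have := dot_ge0 (a *: u - v); rewrite !dotE (dotC v u) => h.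
rewrite -(ler_pM2l a0) mulrDr mulVKf ?gt_eqF//.
by lra.
Qed.

Lemma cauchy_schwarz u v : `|dot u v| <= enorm u * enorm v.
Proof.
rewrite -sqrtrM ?dot_ge0// -sqrtr_sqr ler_wsqrtr//.
have [v0|v0] := eqVneq (dot v v) 0.
  by rewrite (dot_eq0 v0) !dot0r expr0n mulr0.
have vgt : 0 < dot v v by rewrite lt_neqAle eq_sym v0 dot_ge0.
have := dot_ge0 (dot v v *: u - dot u v *: v); rewrite !dotE (dotC v u) => h.
rewrite -(ler_pM2l vgt); lra.
Qed.

Lemma dot_le_enorm u v : dot u v <= enorm u * enorm v.
Proof. exact: le_trans (ler_norm _) (cauchy_schwarz u v). Qed.

Lemma ler_enormD u v : enorm (u + v) <= enorm u + enorm v.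
Proof.
rewrite -(@ler_pXn2r _ 2%N)// ?nnegrE ?addr_ge0 ?enorm_ge0//.
rewrite sqrrD !sqr_enorm !dotE (dotC v u).
have := dot_le_enorm u v; lra.
Qed.

Lemma ler_enormB u v : enorm (u - v) <= enorm u + enorm v.
Proof. by rewrite -(enormN v); exact: ler_enormD. Qed.

Lemma ler_enorm_dist w u v : enorm (u - v) <= enorm (u - w) + enorm (w - v).
Proof. by rewrite -(subrKA w u (- v)); exact: ler_enormD. Qed.

Lemma ler_enorm_sum (I : Type) (r : seq I) (P : pred I) (F : I -> 'rV[R]_p) :
  enorm (\sum_(i <- r | P i) F i) <= \sum_(i <- r | P i) enorm (F i).
Proof.
elim/big_ind2 : _ => // [|x1 x2 y1 y2 h1 h2].
  by rewrite /enorm dot0l sqrtr0.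
by rewrite (le_trans (ler_enormD _ _))// lerD.
Qed.

Lemma enorm_le_dot a u : 0 <= a -> dot u u <= a ^+ 2 -> enorm u <= a.
Proof.
by move=> a0; rewrite -sqr_enorm ler_pXn2r ?nnegrE ?enorm_ge0.
Qed.

Lemma normr_le_enorm u : `|u| <= enorm u.
Proof.
rewrite [leLHS]/Num.Def.normr/= mx_normrE (bigmax_le _ (enorm_ge0 u))//.
move=> [i j] _ /=; rewrite (ord1 i) -sqrtr_sqr ler_wsqrtr//.
rewrite /dot (bigD1 j)//= -expr2 lerDl.
by apply: sumr_ge0 => k _; rewrite -expr2 sqr_ge0.
Qed.

Lemma enorm_le_normr u : enorm u <= p%:R * `|u|.
Proof.
apply: enorm_le_dot; first by rewrite mulr_ge0.
rewrite exprMn -natrX.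
have h i : u ord0 i * u ord0 i <= `|u| ^+ 2.
  rewrite -expr2 -real_normK ?num_real// ler_pXn2r ?nnegrE//.
  rewrite [leRHS]/Num.Def.normr/= mx_normrE.
  exact: (le_bigmax _ (fun ij => `|u ij.1 ij.2|) (ord0, i)).
apply: (@le_trans _ _ (\sum_(i < p) `|u| ^+ 2)); first exact: ler_sum.
rewrite sumr_const card_ord -[leLHS]mulr_natl ler_wpM2r ?sqr_ge0//.
by rewrite ler_nat; case: (p) => // n; rewrite -[leqLHS]expn1 leq_pexp2l.
Qed.

Lemma continuous_enorm_sub v : continuous (fun u => enorm (u - v)).
Proof.
move=> u; apply/(@cvgrPdist_le _ _ _ (nbhs u)) => /= eps eps0.
near=> w.
have h : `|enorm (u - v) - enorm (w - v)| <= enorm (u - w).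
  have h1 := ler_enorm_dist w u v; have h2 := ler_enorm_dist u w v.
  by rewrite (enormBC w u) in h2; rewrite ler_norml; apply/andP; split; lra.
apply: (le_trans h); apply: (le_trans (enorm_le_normr _)).
(* Passing from [p] to [p.+1] keeps the divisor positive in dimension 0. *)
apply: (@le_trans _ _ (p.+1%:R * `|u - w|)).
  by rewrite ler_wpM2r// ler_nat.
rewrite mulrC -ler_pdivlMr ?ltr0n//.
near: w; have := @cvg_id _ (nbhs u); move/cvgrPdist_le; apply.
by rewrite divr_gt0// ltr0n.
Unshelve. all: by end_near. Qed.

End Euclidean.

(** * Minimization and projection on convex sets *)

(** This replaces the passage to the limit in first-order arguments. The case t = 1 gives [a <= b],
    so if [a] were positive, t = a / (2b) would be admissible and would give a <= a/2. *)
Lemma le0_of_le_small (R : realType) (a b : R) :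
  (forall t, 0 < t -> t <= 1 -> a <= t * b) -> a <= 0.
Proof.
move=> h; rewrite leNgt; apply/negP => a0.
have ab : a <= b by rewrite -(mul1r b) h.
have b0 : 0 < b by exact: lt_le_trans ab.
have : a <= a / (2 * b) * b.
  apply: h; first by rewrite divr_gt0// mulr_gt0.
  by rewrite ler_pdivrMr ?mulr_gt0//; lra.
have -> : a / (2 * b) * b = a / 2 by field; rewrite gt_eqF.
lra.
Qed.

Section ConvexMinimization.
Variables (R : realType) (p : nat) (Omega : set 'rV[R]_p).
Implicit Types (u v w x y : 'rV[R]_p).

Lemma convex_segment (t : R) x y : @convex_set R 'rV[R]_p Omega ->
  Omega x -> Omega y -> 0 <= t -> t <= 1 -> Omega (x + t *: (y - x)).
Proof.
move=> cO Ox Oy t0 t1.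
have := set_mem (cO y x (@Itv01 R t t0 t1) (mem_set Oy) (mem_set Ox)).
rewrite -[conv _ _ _]/(t *: y + (1 - t) *: x); congr Omega.
by rewrite scalerBl scale1r scalerBr addrCA.
Qed.

(** The variational inequality of first-order optimality. Differentiability relative to [Omega]
    suffices, because the segment from [y] to [v] stays in [Omega] by convexity. *)
Lemma argmin_gradient (F : 'rV[R]_p -> R) (G : 'rV[R]_p -> 'rV[R]_p) y :
  @convex_set R 'rV[R]_p Omega -> is_gradient_on Omega F G ->
  is_argmin Omega F y -> forall v, Omega v -> 0 <= dot (G y) (v - y).
Proof.
move=> cO gF [Oy ymin] v Ov; rewrite -oppr_le0.
have [->|vy] := eqVneq v y; first by rewrite subrr dot0r oppr0.
have nvy : 0 < enorm (v - y).
  rewrite lt_neqAle enorm_ge0 andbT eq_sym; apply: contraNneq vy => h.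
  by apply/eqP/subr0_eq/enorm0_eq0; rewrite h.
apply: (@le0_of_le_small _ _ (enorm (v - y))) => eps eps0 _.
have /nbhs_ballP[r /= r0 hr] := gF y Oy eps eps0.
(* Short enough for the point at parameter [t] to lie in the sup-norm ball of radius [r]; the
   summand 1 keeps the denominator positive. *)
pose t := Num.min 1 (r / 2 / (p%:R * `|v - y| + 1)).
have d0 : 0 < p%:R * `|v - y| + 1 by rewrite ltr_wpDl// mulr_ge0.
have t0 : 0 < t by rewrite lt_min ltr01/= divr_gt0// divr_gt0.
have t1 : t <= 1 by rewrite ge_min lexx.
have Oz := convex_segment cO Oy Ov (ltW t0) t1.
set z := y + t *: (v - y) in Oz.
have zy : z - y = t *: (v - y) by rewrite /z addrC addKr.
have : ball y r z.
  rewrite -ball_normE/= distrC zy normrZ gtr0_norm//.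
  have : t * `|v - y| <= t * enorm (v - y).
    by rewrite ler_pM2l// normr_le_enorm.
  move=> h; apply: (le_lt_trans h).
  have h2 : t * (p%:R * `|v - y| + 1) <= r / 2.
    by rewrite -ler_pdivlMr// ge_min lexx orbT.
  have h3 : t * enorm (v - y) <= t * (p%:R * `|v - y| + 1).
    by rewrite ler_pM2l// (le_trans (enorm_le_normr _))// lerDl.
  by apply: (le_lt_trans (le_trans h3 h2)); lra.
move=> /hr/(_ Oz); rewrite zy enormZ (gtr0_norm t0) dotZr ler_norml => /andP[_].
have := ymin z Oz => h1 h2.
rewrite -(ler_pM2l t0); lra.
Qed.

Lemma is_gradient_on_continuous (F : 'rV[R]_p -> R) G :
  is_gradient_on Omega F G -> {within Omega, continuous F}.
Proof.
move=> gF; apply/subspace_continuousP => x Ox.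
apply/cvgrPdist_le => eps eps0.
have /nbhs_ballP[r /= r0 hr] := gF x Ox 1 ltr01.
pose M := (1 + enorm (G x)) * p%:R + 1.
have M0 : 0 < M by rewrite ltr_wpDl// mulr_ge0// addr_ge0// enorm_ge0.
apply/nbhs_ballP; exists (Num.min r (eps / M)); first by rewrite /= lt_min r0/= divr_gt0.
move=> z /= xz Oz; have xz' : ball x r z.
  by apply: le_ball xz; rewrite ge_min lexx.
have {xz} xz : `|x - z| <= eps / M.
  move: xz; rewrite -ball_normE/= lt_min => /andP[_ /ltW//].
have {hr} h := hr z xz' Oz.
have h2 := cauchy_schwarz (G x) (z - x).
have h3 : (1 + enorm (G x)) * enorm (z - x) <= eps.
  apply: (@le_trans _ _ (M * `|x - z|)); last first.
    by rewrite mulrC -ler_pdivlMr.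
  rewrite /M mulrDl mul1r.
  have : (1 + enorm (G x)) * enorm (z - x) <=
         (1 + enorm (G x)) * (p%:R * `|z - x|).
    by rewrite ler_wpM2l ?addr_ge0 ?enorm_ge0// enorm_le_normr.
  rewrite (distrC z x) => h3; have := normr_ge0 (x - z); lra.
rewrite distrC; apply: le_trans h3.
rewrite -(subrK (dot (G x) (z - x)) (F z - F x)).
apply: (le_trans (ler_normD _ _)); lra.
Qed.

Lemma is_gradient_on_sum (n : nat) (f : 'I_n -> 'rV[R]_p -> R)
    (g : 'I_n -> 'rV[R]_p -> 'rV[R]_p) :
  (forall i, is_gradient_on Omega (f i) (g i)) ->
  is_gradient_on Omega (fun y => \sum_(i < n) f i y)
    (fun y => \sum_(i < n) g i y).
Proof.
move=> fg x Ox eps eps0.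
have e0 : 0 < eps / n.+1%:R by rewrite divr_gt0.
have : \forall y \near within Omega (nbhs x), forall i,
    `|f i y - f i x - dot (g i x) (y - x)| <= eps / n.+1%:R * enorm (y - x).
  by apply: filter_forall => i; exact: fg.
apply: filterS => y hy.
rewrite dot_suml -!sumrB (le_trans (ler_norm_sum _ _ _))//.
apply: (@le_trans _ _ (\sum_(i < n) eps / n.+1%:R * enorm (y - x))).
  exact: ler_sum.
rewrite sumr_const card_ord -[leLHS]mulr_natl mulrA ler_wpM2r ?enorm_ge0//.
by rewrite mulrCA ger_pMr// ler_pdivrMr ?ltr0n// mul1r ler_nat.
Qed.

Lemma continuous_argmin (F : 'rV[R]_p -> R) : compact Omega ->
  Omega !=set0 -> {within Omega, continuous F} -> exists y, is_argmin Omega F y.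
Proof.
move=> cO O0 cF; have [c /set_mem Oc h] := EVT_min_rV O0 cO cF.
by exists c; split=> // v Ov; apply: h; rewrite inE.
Qed.

End ConvexMinimization.

Section Projection.
Variables (R : realType) (p : nat) (Omega : set 'rV[R]_p).
Hypothesis Omega_convex : @convex_set R 'rV[R]_p Omega.
Hypothesis Omega_compact : compact Omega.
Hypothesis Omega_neq0 : Omega !=set0.
Implicit Types (u v w x y : 'rV[R]_p).
Local Notation P := (Defs.proj Omega).

(** [proj] is defined by [get], which is meaningful only once a minimizer exists; compactness
    provides one. *)
Lemma proj_argmin x :
  is_argmin Omega (fun v => enorm (v - x) ^+ 2) (P x).
Proof.
apply: (getPex (P := [set y | is_argmin Omega _ y])).
apply: continuous_argmin => //.
apply: continuous_subspaceT => y.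
have c := @continuous_enorm_sub R p x y.
exact: (@continuousM R 'rV[R]_p _ _ y c c).
Qed.

Lemma proj_in x : Omega (P x).
Proof. by have [] := proj_argmin x. Qed.

(** The residual [x - P x] lies in the normal cone at [P x]: comparing [P x] with a point at
    parameter t of the segment to [v] bounds twice the inner product by t times a constant. *)
Lemma proj_normal x v : Omega v -> dot (x - P x) (v - P x) <= 0.
Proof.
move=> Ov; have [OP minP] := proj_argmin x.
have : 2 * dot (x - P x) (v - P x) <= 0; last lra.
apply: (@le0_of_le_small _ _ (dot (v - P x) (v - P x))) => t t0 t1.
have := minP _ (convex_segment Omega_convex OP Ov (ltW t0) t1).
have -> : P x + t *: (v - P x) - x = t *: (v - P x) - (x - P x).
  by rewrite opprB addrCA addrA.
rewrite !sqr_enorm -(opprB x (P x)).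
move: (v - P x) (x - P x) => d b.
rewrite !dotE (dotC d b) => h.
by rewrite -(ler_pM2l t0); lra.
Qed.

(** Sum of the normal cone inequalities at [P x] and [P y], each tested with the other
    projection. *)
Lemma proj_firmly_nonexpansive x y :
  dot (P x - P y) (P x - P y) <= dot (P x - P y) (x - y).
Proof.
have h1 := proj_normal x (proj_in y); have h2 := proj_normal y (proj_in x).
move: h1 h2; rewrite -(opprB (P x) (P y)).
have -> : x - y = (x - P x) - (y - P y) + (P x - P y).
  by apply/rowP => i; rewrite !mxE; ring.
move: (P x - P y) (x - P x) (y - P y) => d a b.
by rewrite !dotE (dotC d a) (dotC d b); lra.
Qed.

Lemma proj_nonexpansive x y : enorm (P x - P y) <= enorm (x - y).
Proof.
have h := proj_firmly_nonexpansive x y; have h2 := dot_le_enorm (P x - P y) (x - y).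
rewrite -sqr_enorm in h.
have [n0|n0] := leP (enorm (P x - P y)) 0.
  exact: le_trans n0 (enorm_ge0 _).
rewrite -(ler_pM2l n0) -expr2; exact: le_trans h2.
Qed.

End Projection.

(** * Graph Laplacian *)

Section GraphEnergy.
Variables (R : realType) (N p : nat) (e : rel 'I_N).
Hypothesis e_sym : symmetric e.
Implicit Types x y : 'I_N -> 'rV[R]_p.

Definition mean x : 'rV[R]_p := N%:R^-1 *: \sum_(i < N) x i.

(** The negative of the graph Laplacian, with the sign it has in the dynamics. *)
Definition laplace x (i : 'I_N) : 'rV[R]_p :=
  \sum_(j < N) adj R e i j *: (x j - x i).

(** The sum runs over ordered pairs and counts every edge twice, hence the factor 1/2 in the
    summation by parts below. *)
Definition edge_energy x : R :=
  \sum_(i < N) \sum_(j < N) adj R e i j * dot (x j - x i) (x j - x i).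

Lemma adj_ge0 i j : 0 <= adj R e i j. Proof. exact: ler0n. Qed.

Lemma adjC i j : adj R e i j = adj R e j i.
Proof. by rewrite /adj e_sym. Qed.

(** Discrete Green formula, by exchanging the two indices. The bilinear form matters: with the
    projections as [x] and the states as [y], firm nonexpansiveness gives each summand a sign. *)
Lemma sum_dot_laplace x y :
  \sum_(i < N) dot (x i) (laplace y i) =
  - (2^-1 * \sum_(i < N) \sum_(j < N)
               adj R e i j * dot (x j - x i) (y j - y i)).
Proof.
pose S := \sum_(i < N) \sum_(j < N) adj R e i j * dot (x i) (y j - y i).
have -> : \sum_(i < N) dot (x i) (laplace y i) = S.
  apply: eq_bigr => i _; rewrite dot_sumr.
  by apply: eq_bigr => j _; rewrite dotZr.
have S' : S = \sum_(i < N) \sum_(j < N) adj R e i j * dot (x j) (y i - y j).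
  rewrite /S exchange_big/=; apply: eq_bigr => i _; apply: eq_bigr => j _.
  by rewrite adjC.
suff -> : \sum_(i < N) \sum_(j < N) adj R e i j * dot (x j - x i) (y j - y i) =
    - (S + S) by field.
rewrite {1}S' /S -big_split -sumrN; apply: eq_bigr => i _ /=.
rewrite -big_split -sumrN; apply: eq_bigr => j _ /=.
by rewrite !dotE; ring.
Qed.

Lemma sum_laplace x : \sum_(i < N) laplace x i = 0.
Proof.
pose S := \sum_(i < N) laplace x i; rewrite -/S.
have : S = - S.
  rewrite {1}/S /laplace exchange_big/= -sumrN; apply: eq_bigr => i _.
  rewrite /laplace -sumrN; apply: eq_bigr => j _.
  by rewrite adjC -scalerN opprB.
move=> SN; apply/eqP.
have : S *+ 2 == 0 by rewrite mulr2n {2}SN subrr.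
by rewrite -scaler_nat scaler_eq0 pnatr_eq0.
Qed.

(** The gap between the two sides is half the sum of all |x_i - x_j|^2. *)
Lemma sqr_sum_le x :
  dot (\sum_(i < N) x i) (\sum_(i < N) x i) <= N%:R * \sum_(i < N) dot (x i) (x i).
Proof.
have : 0 <= \sum_(i < N) \sum_(j < N) dot (x i - x j) (x i - x j).
  by apply: sumr_ge0 => i _; apply: sumr_ge0 => j _; exact: dot_ge0.
have -> : \sum_(i < N) \sum_(j < N) dot (x i - x j) (x i - x j) =
   2 * (N%:R * \sum_(i < N) dot (x i) (x i) -
        dot (\sum_(i < N) x i) (\sum_(i < N) x i)); last by lra.
have h1 : \sum_(i < N) \sum_(j < N) dot (x i) (x i) =
    N%:R * \sum_(i < N) dot (x i) (x i).
  rewrite mulr_sumr; apply: eq_bigr => i _.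
  by rewrite sumr_const card_ord mulr_natl.
have h2 : \sum_(i < N) \sum_(j < N) dot (x j) (x j) =
    N%:R * \sum_(i < N) dot (x i) (x i).
  by rewrite exchange_big h1.
have h3 : \sum_(i < N) \sum_(j < N) dot (x i) (x j) =
    dot (\sum_(i < N) x i) (\sum_(i < N) x i).
  by rewrite dot_suml; apply: eq_bigr => i _; rewrite dot_sumr.
rewrite -h3 mulrBr mulr2n !mulrDl !mul1r -{1}h1 -h2 -!big_split -sumrB /=.
apply: eq_bigr => i _; rewrite -!big_split -sumrB /=; apply: eq_bigr => j _.
by rewrite !dotE (dotC (x j) (x i)); ring.
Qed.

Lemma edge_energy_ge0 x : 0 <= edge_energy x.
Proof.
by apply: sumr_ge0 => i _; apply: sumr_ge0 => j _; rewrite mulr_ge0 ?dot_ge0 ?adj_ge0.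
Qed.

Lemma edge_energy_ge x i j : e i j ->
  dot (x j - x i) (x j - x i) <= edge_energy x.
Proof.
move=> eij; rewrite /edge_energy (bigD1 i)//= (bigD1 j)//= /adj eij mul1r.
rewrite -addrA lerDl addr_ge0//.
  by apply: sumr_ge0 => k _; rewrite mulr_ge0 ?dot_ge0 ?ler0n.
apply: sumr_ge0 => k _; apply: sumr_ge0 => l _.
by rewrite mulr_ge0 ?dot_ge0 ?ler0n.
Qed.

(** Induction along a path, using |u - v|^2 <= 2|u|^2 + 2|v|^2 at each edge. The constant is
    wasteful but depends on the path alone, not on [x]. *)
Lemma connect_energy i j : connect e i j ->
  exists2 C : R, 0 <= C &
    forall x, dot (x i - x j) (x i - x j) <= C * edge_energy x.
Proof.
move=> /connectP[q + ->]; elim: q i => [|k q IH] i /=.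
  by move=> _; exists 0 => // x; rewrite subrr dot0l mul0r.
move=> /andP[eik /IH[C C0 hC]]; exists (2 + 2 * C); first lra.
move=> x; have := hC x; have := edge_energy_ge x eik.
have := dot_ge0 ((x k - x i) + (x k - x (last k q))).
have -> : x i - x (last k q) = (x k - x (last k q)) - (x k - x i).
  by apply/rowP => l; rewrite !mxE; ring.
move: (x k - x (last k q)) (x k - x i) => u v.
rewrite !dotE (dotC u v); lra.
Qed.

Lemma sum_dot_mean_center x (u : 'rV[R]_p) : (0 < N)%N ->
  \sum_(i < N) dot (x i - mean x) u = 0.
Proof.
move=> N0; rewrite -dot_suml sumrB sumr_const card_ord /mean -scaler_nat.
by rewrite scalerA divff ?scale1r ?subrr ?dot0l// pnatr_eq0 -lt0n.
Qed.

Hypothesis e_conn : forall i j : 'I_N, connect e i j.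

(** Poincare inequality of a connected graph: x_i minus the mean is the average of the differences
    x_i - x_j, each controlled by the energy along a path. *)
Lemma energy_poincare : exists2 K : R, 0 < K &
  forall x, \sum_(i < N) dot (x i - mean x) (x i - mean x) <= K * edge_energy x.
Proof.
pose C i j := s2val (cid2 (connect_energy (e_conn i j))).
have C0 i j : 0 <= C i j by rewrite /C; case: cid2.
have hC i j x : dot (x i - x j) (x i - x j) <= C i j * edge_energy x.
  by rewrite /C; case: cid2.
exists (1 + \sum_(i < N) \sum_(j < N) C i j).
  by rewrite ltr_wpDr//; apply: sumr_ge0 => i _; exact: sumr_ge0.
move=> x; rewrite mulrDl mul1r mulr_suml.
apply: (@le_trans _ _ (\sum_(i < N) (\sum_(j < N) C i j) * edge_energy x)); last first.
  by rewrite lerDr edge_energy_ge0.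
apply: ler_sum => i _.
have N0 : (0 < N%:R :> R) by rewrite ltr0n (leq_ltn_trans _ (ltn_ord i)).
have -> : x i - mean x = N%:R^-1 *: \sum_(j < N) (x i - x j).
  rewrite sumrB sumr_const card_ord scalerBr -[x i *+ N]scaler_nat scalerA mulVf ?gt_eqF//.
  by rewrite scale1r.
rewrite dotZl dotZr; have := sqr_sum_le (fun j => x i - x j).
set A := dot _ _; set B := \sum_(j < N) dot _ _ => AB.
apply: (@le_trans _ _ (N%:R^-1 * B)).
  by rewrite ler_pM2l ?invr_gt0// mulrC ler_pdivrMr// mulrC.
have B0 : 0 <= B by apply: sumr_ge0 => j _; exact: dot_ge0.
apply: (@le_trans _ _ B).
  rewrite ler_piMl// invf_le1// (_ : 1 = 1%:R)// ler_nat.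
  exact: leq_ltn_trans (ltn_ord i).
by rewrite mulr_suml; apply: ler_sum => j _; exact: hC.
Qed.

End GraphEnergy.

(** * Absolutely continuous functions *)

(** First-order expansion without a difference quotient: it also covers [u = t], so increments on
    both sides of [t] can be combined. *)
Lemma is_derive_increment (R : realType) (V : normedModType R) (x : R -> V)
    (t : R) (v : V) : is_derive t 1 x v -> forall eps, 0 < eps ->
  exists2 d, 0 < d & forall u, `|u - t| < d ->
    `|x u - x t - (u - t) *: v| <= eps * `|u - t|.
Proof.
move=> [dx <-] eps eps0.
have := dx => /cvgrPdist_le/(_ eps eps0)/nbhs_ballP[d /= d0 hd].
exists d => // u ut.
have [->|uNt] := eqVneq u t; first by rewrite !subrr scale0r subr0 !normr0 mulr0.
have ut0 : u - t != 0 by rewrite subr_eq0.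
have := hd (u - t); rewrite -ball_normE/= sub0r normrN => /(_ ut ut0).
rewrite [(u - t) *: 1]mulr1 subrK => h.
have -> : x u - x t - (u - t) *: 'D_1 x t =
    - ((u - t) *: ('D_1 x t - (u - t)^-1 *: (x u - x t))).
  by rewrite scalerBr scalerA divff// scale1r opprB.
by rewrite normrN normrZ mulrC ler_pM2r// normr_gt0.
Qed.

Lemma increment_is_derive (R : realType) (h : R -> R) (t d : R) :
  (forall eps, 0 < eps -> exists2 del, 0 < del & forall u, `|u - t| < del ->
    `|h u - h t - (u - t) * d| <= eps * `|u - t|) ->
  is_derive t 1 h d.
Proof.
move=> H.
have cv : (fun s : R => s^-1 *: ((h \o shift t) (s *: 1) - h t)) @ 0^' --> d.
  apply/cvgrPdist_le => eps eps0; have [del del0 hdel] := H eps eps0.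
  apply/nbhs_ballP; exists del => //= s; rewrite -ball_normE/= sub0r normrN => sd s0.
  have := hdel (s + t); rewrite addrK => /(_ sd) h1.
  rewrite /GRing.scale/= mulr1 -(ler_pM2r (_ : 0 < `|s|)) ?normr_gt0// -normrM.
  rewrite distrC in h1.
  have -> : (d - s^-1 * (h (s + t) - h t)) * s = s * d - (h (s + t) - h t).
    by field.
  by [].
by apply: DeriveDef; [apply/cvg_ex; exists d | exact: cvg_lim].
Qed.

(** Real induction. The step transfers [Q] across [t] from any nearby point on its left to any
    nearby point on its right; at the supremum of the points where [Q] holds, it would reach beyond
    the supremum unless that is within [d] of [b]. *)
Lemma segment_induction (R : realType) (a b : R) (Q : R -> Prop) : a <= b ->
  Q a ->
  (forall t, a <= t -> t <= b -> exists2 d, 0 < d & forall u v,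
     a <= u -> u <= t -> t <= v -> v <= b -> t - d < u -> v < t + d ->
     Q u -> Q v) ->
  Q b.
Proof.
move=> ab Qa step.
pose S := [set t | [/\ a <= t, t <= b & Q t]].
have hS : has_sup S.
  by split; [exists a; split | exists b => t []].
pose c := sup S.
have ac : a <= c by apply: sup_upper_bound => //; split.
have cb : c <= b by apply: ge_sup => //; [exists a; split | move=> t []].
have [d d0 hd] := step c ac cb.
have [u [au ub Qu] du] := sup_adherent d0 hS.
have uc : u <= c by apply: sup_upper_bound => //; split.
have [bd|db] := ltP b (c + d); first exact: (hd u b).
pose v := c + d / 2.
have vb : v <= b by apply: le_trans db; rewrite /v; lra.
have Qv : Q v by apply: (hd u v) => //; rewrite /v; lra.
have : v <= c.
  by apply: sup_upper_bound => //; split=> //; rewrite /v; lra.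
by rewrite /v; lra.
Qed.

(** The condition of absolute continuity for an arbitrary function [m] of intervals. Norms of vector
    increments, absolute values of scalar ones and lengths are all instances, so closure properties
    reduce to inequalities between such functions. *)
Definition small_variation (R : realType) (a b : R) (m : R -> R -> R) : Prop :=
  forall eps : R, 0 < eps -> exists2 delta : R, 0 < delta &
    forall (n : nat) (l r : 'I_n -> R),
      (forall k, [/\ a <= l k, l k <= r k & r k <= b]) ->
      trivIset [set: 'I_n] (fun k => `]l k, r k[%classic) ->
      \sum_(k < n) (r k - l k) < delta ->
      \sum_(k < n) m (l k) (r k) < eps.

Section SmallVariation.
Variables (R : realType) (a b : R).
Implicit Types m : R -> R -> R.

Lemma small_variation_len : small_variation a b (fun u v => v - u).
Proof. by move=> eps eps0; exists eps. Qed.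

Lemma small_variation0 : small_variation a b (fun _ _ => 0).
Proof. by move=> eps eps0; exists 1 => // n l r _ _ _; rewrite big1. Qed.

Lemma small_variationD m1 m2 : small_variation a b m1 ->
  small_variation a b m2 -> small_variation a b (fun u v => m1 u v + m2 u v).
Proof.
move=> h1 h2 eps eps0; have e2 : 0 < eps / 2 by lra.
have [d1 d10 hd1] := h1 _ e2; have [d2 d20 hd2] := h2 _ e2.
exists (Num.min d1 d2); first by rewrite lt_min d10.
move=> n l r lr tr; rewrite lt_min => /andP[s1 s2].
rewrite big_split/=; have := hd1 n l r lr tr s1; have := hd2 n l r lr tr s2.
by lra.
Qed.

Lemma small_variation_sum n (m : 'I_n -> R -> R -> R) :
  (forall i, small_variation a b (m i)) ->
  small_variation a b (fun u v => \sum_(i < n) m i u v).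
Proof.
elim: n m => [|n IH] m hm.
  by move=> eps eps0; exists 1 => // k l r _ _ _; rewrite big1 // => i _; rewrite big_ord0.
have -> : (fun u v => \sum_(i < n.+1) m i u v) =
  (fun u v => \sum_(i < n) m (widen_ord (leqnSn n) i) u v + m ord_max u v).
  by apply/funext => u; apply/funext => v; rewrite big_ord_recr.
by apply: small_variationD; [apply: IH => i; exact: hm | exact: hm].
Qed.

Lemma small_variation_le C m1 m2 : 0 < C ->
  (forall u v, a <= u -> u <= v -> v <= b -> m1 u v <= C * m2 u v) ->
  small_variation a b m2 -> small_variation a b m1.
Proof.
move=> C0 le h eps eps0; have e0 : 0 < eps / C by rewrite divr_gt0.
have [d d0 hd] := h _ e0; exists d => // n l r lr tr s.
have := hd n l r lr tr s; rewrite ltr_pdivlMr// mulrC mulr_sumr.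
by apply: le_lt_trans; apply: ler_sum => k _; have [? ? ?] := lr k; exact: le.
Qed.

End SmallVariation.

(** * Monotonicity from the sign of the derivative almost everywhere *)

Section AbsolutelyContinuousMonotone.
Variable R : realType.
Notation mu := (@lebesgue_measure R).

Lemma sum_length_le_measure (n : nat) (l r : 'I_n -> R) (U : set R) :
  measurable U -> (forall k, l k <= r k) ->
  (forall k, `]l k, r k[%classic `<=` U) ->
  trivIset [set: 'I_n] (fun k => `]l k, r k[%classic) ->
  ((\sum_(k < n) (r k - l k))%:E <= mu U)%E.
Proof.
move=> mU lr sub tr.
have -> : (\sum_(k < n) (r k - l k))%:E =
    (\sum_(k < n) mu (`]l k, r k[%classic : set R))%E.
  rewrite -sumEFin; apply: eq_bigr => k _.
  rewrite lebesgue_measure_itv/= lte_fin; case: ltP => // rl.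
  by have -> : l k = r k; [apply/eqP; rewrite eq_le lr rl | rewrite subrr].
rewrite -(@measure_bigsetU_ord _ _ _ mu n xpredT (fun k => `]l k, r k[%classic))//.
apply: le_measure; rewrite ?inE//.
  by apply: bigsetU_measurable => k _; exact: measurable_itv.
elim/big_ind : _ => [|A B hA hB|k _]; [exact: sub0set | | exact: sub].
by move=> x [/hA|/hB].
Qed.

(* Real induction on [Q t]: the increment of [h] over [a, t] is at most
   [eps * (t - a)] plus the variation of [h] on finitely many disjoint intervals
   inside an open set of small measure that covers the exceptional null set. *)
Lemma ac_nonincreasing (a b : R) (h : R -> R) : a <= b ->
  small_variation a b (fun u v => `|h v - h u|) ->
  {ae mu, forall t : R, a < t -> t < b ->
     exists2 d, d <= 0 & is_derive t 1 h d} ->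
  h b <= h a.
Proof.
move=> ab hac [A [mA muA0 subA]].
have [<-//|altb] := eqVneq a b.
have {altb ab} ltab : a < b by rewrite lt_neqAle altb ab.
suff : forall eps, 0 < eps -> h b - h a <= eps * (b - a) + eps.
  move=> h1; rewrite -subr_le0.
  apply: (@le0_of_le_small _ _ (b - a + 1)) => t t0 _.
  by rewrite mulrDr mulr1 h1.
move=> eps eps0; have [delta delta0 hdelta] := hac eps eps0.
(* The endpoints join the exceptional set, since the derivative is known only in the open
   interval. *)
pose A' := A `|` [set a] `|` [set b].
have mA' : measurable A' by apply: measurableU => //; exact: measurableU.
have muA' : mu A' = 0.
  have null1 x : mu.-negligible [set x].
    by exists [set x]; split=> //; exact: lebesgue_measure_set1.
  apply: measure_negligible => //; apply: negligibleU => //.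
  by apply: negligibleU => //; exists A; split.
have [U [oU AU muU]] : exists U : set R,
    [/\ open U , A' `<=` U & mu (U `\` A') < delta%:E]%E.
  by apply: lebesgue_regularity_outer => //; rewrite [ltLHS]muA'.
have mU : measurable U by exact: measurable_realfun.open_measurable.
have {}muU : (mu U < delta%:E)%E.
  apply: le_lt_trans muU.
  have -> : mu U = mu ((U `\` A') `|` A').
    by rewrite setUC setDUK.
  apply: (le_trans (measureU2 _ _ _)) => //; first exact: measurableD.
  by rewrite [X in (_ + X)%E]muA' adde0.
(* The intervals are indexed by [nat] so that one can be appended. They are closed inside [U], yet
   consecutive ones may share an endpoint. *)
pose Q t := exists (n : nat) (l r : nat -> R),
  [/\ forall k, (k < n)%N -> [/\ a <= l k, l k <= r k & r k <= t],
      forall j k, (j < k)%N -> (k < n)%N -> r j <= l k,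
      forall k, (k < n)%N -> `[l k, r k]%classic `<=` U &
      h t - h a <= eps * (t - a) + \sum_(k < n) `|h (r k) - h (l k)|].
have : Q b.
  apply: (segment_induction (ltW ltab)).
    by exists 0%N, (fun _ => 0), (fun _ => 0); split=> //; rewrite big_ord0; lra.
  move=> t at_ tb.
  (* Near a point of [U] the interval from [u] to [v] is appended to the list; elsewhere the
     derivative at [t] is nonpositive, and the expansions at [u] and [v] bound the increment by
     [eps * (v - u)]. *)
  have [Ut|nUt] := pselect (U t).
    have /nbhs_ballP[d /= d0 hd] : nbhs t U by exact: open_nbhs_nbhs.
    exists d => // u v au ut tv vb du dv [n [l [r [lr dis sub hh]]]].
    exists n.+1, (fun k => if k == n then u else l k),
      (fun k => if k == n then v else r k); split.
    + move=> k; rewrite ltnS leq_eqVlt; case: eqP => //= _.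
        by move=> _; split=> //; exact: le_trans tv.
      by move=> /lr[? ? ?]; split=> //; lra.
    + move=> j k jk; rewrite ltnS => kn.
      have jn : (j < n)%N by exact: leq_trans kn.
      rewrite (ltn_eqF jn); case: eqP => [_|/eqP kn'].
        by have [_ _] := lr j jn.
      by apply: dis => //; rewrite ltn_neqAle kn'.
    + move=> k; rewrite ltnS leq_eqVlt; case: eqP => //= [_ _|_]; last exact: sub.
      move=> x /=; rewrite in_itv/= => /andP[ux xv]; apply: hd.
      by rewrite -ball_normE/= ltr_norml; apply/andP; split; lra.
    + rewrite big_ord_recr/= eqxx.
      under eq_bigr => k _ do rewrite (ltn_eqF (ltn_ord k)).
      have := ler_norm (h v - h u).
      have : 0 <= eps * (v - u) by rewrite mulr_ge0 ?(ltW eps0)// subr_ge0 (le_trans ut).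
      by move: hh; lra.
  have nAt : ~ A' t by move=> /AU.
  have tA : a < t.
    by rewrite lt_neqAle at_ andbT; apply/eqP => ta; apply: nAt; rewrite /A' -ta; left; right.
  have tB : t < b.
    by rewrite lt_neqAle tb andbT; apply/eqP => ta; apply: nAt; rewrite /A' ta; right.
  have [d dle0 dht] : exists2 d, d <= 0 & is_derive t 1 h d.
    have : ~ A t by move=> At; apply: nAt; left; left.
    by move=> nA; apply: contrapT => nd; apply: nA; apply: subA => /= /(_ tA tB).
  have [del del0 hdel] := is_derive_increment dht eps0.
  exists del => // u v au ut tv vb du dv [n [l [r [lr dis sub hh]]]].
  exists n, l, r; split=> //.
    by move=> k /lr[? ? ?]; split=> //; lra.
  have /ler_normlP[h1 _] : `|h u - h t - (u - t) *: d| <= eps * `|u - t|.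
    by apply: hdel; rewrite ltr_norml; apply/andP; split; lra.
  have /ler_normlP[_ h2] : `|h v - h t - (v - t) *: d| <= eps * `|v - t|.
    by apply: hdel; rewrite ltr_norml; apply/andP; split; lra.
  rewrite ler0_norm ?subr_le0// in h1; rewrite ger0_norm ?subr_ge0// in h2.
  have h3 : (v - u) * d <= 0 by rewrite mulr_ge0_le0// subr_ge0; exact: le_trans tv.
  move: h1 h2; rewrite /GRing.scale/= => h1 h2.
  by lra.
move=> [n [l [r [lr dis sub hh]]]].
have tr : trivIset [set: 'I_n] (fun k : 'I_n => `]l k, r k[%classic).
  apply/trivIsetP => j k _ _ jk.
  have {jk} [jk|jk] : (j < k)%N \/ (k < j)%N.
    by apply/orP; rewrite -neq_ltn.
  - apply/seteqP; split=> // x [] /=; rewrite !in_itv/= => /andP[_ xr] /andP[lx _].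
    by have := dis _ _ jk (ltn_ord k); lra.
  - apply/seteqP; split=> // x [] /=; rewrite !in_itv/= => /andP[lx _] /andP[_ xr].
    by have := dis _ _ jk (ltn_ord j); lra.
have : \sum_(k < n) `|h (r k) - h (l k)| < eps.
  apply: (hdelta n (fun k => l k) (fun k => r k)) => //.
    by move=> k; exact: lr.
  rewrite -lte_fin; apply: le_lt_trans muU.
  apply: (@sum_length_le_measure n (fun k => l k) (fun k => r k)) => //.
    by move=> k; have [] := lr k (ltn_ord k).
  move=> k; apply: subset_trans (sub k (ltn_ord k)).
  exact: subset_itvW.
by lra.
Qed.

End AbsolutelyContinuousMonotone.

(** * Stability of absolute continuity under algebraic operations *)

Section AbsoluteContinuityClosure.
Variables (R : realType) (a b : R).
Implicit Types phi psi : R -> R.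

Definition ac phi := small_variation a b (fun u v => `|phi v - phi u|).

Lemma small_variation_step m eps : small_variation a b m -> 0 < eps ->
  exists2 d, 0 < d & forall u v, a <= u -> u <= v -> v <= b -> v - u < d ->
    m u v < eps.
Proof.
move=> h eps0; have [d d0 hd] := h eps eps0; exists d => // u v au uv vb vud.
have := hd 1%N (fun _ => u) (fun _ => v); rewrite !big_ord1; apply=> //.
by apply/trivIsetP => i j _ _; rewrite !ord1 eqxx.
Qed.

Lemma ac_bounded phi : a <= b -> ac phi ->
  exists2 B, 0 <= B & forall t, a <= t -> t <= b -> `|phi t| <= B.
Proof.
move=> ab h; have [d d0 hd] := small_variation_step h ltr01.
pose Q t := exists2 B, 0 <= B & forall x, a <= x -> x <= t -> `|phi x| <= B.
apply: (@segment_induction _ a b Q) => //.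
  exists `|phi a| => // x ax xa; have -> // : x = a.
  by apply/eqP; rewrite eq_le ax xa.
(* Half of [d], because [u] and [x] may lie on opposite sides of [t] and must still be less than [d]
   apart. *)
move=> t _ _; exists (d / 2); first by rewrite divr_gt0.
move=> u v au ut tv vb tu vt [B B0 hB]; exists (B + 1); first by rewrite addr_ge0.
move=> x ax xv; have [xu|ux] := leP x u; first by rewrite (le_trans (hB x ax xu))// lerDl.
have h1 : `|phi x - phi u| < 1 by apply: hd => //; lra.
have h2 : `|phi u| <= B by exact: hB.
have h3 := ler_normD (phi x - phi u) (phi u); rewrite subrK in h3.
lra.
Qed.

Lemma acD phi psi : ac phi -> ac psi -> ac (fun t => phi t + psi t).
Proof.
move=> h1 h2; apply: (small_variation_le ltr01 _ (small_variationD h1 h2)) => u v _ _ _.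
have -> : phi v + psi v - (phi u + psi u) = (phi v - phi u) + (psi v - psi u).
  by ring.
by rewrite mul1r ler_normD.
Qed.

Lemma ac_sum n (phi : 'I_n -> R -> R) : (forall i, ac (phi i)) ->
  ac (fun t => \sum_(i < n) phi i t).
Proof.
move=> h; apply: (small_variation_le ltr01 _ (small_variation_sum h)) => u v _ _ _.
rewrite mul1r -sumrB; exact: ler_norm_sum.
Qed.

Lemma acZ c phi : ac phi -> ac (fun t => c * phi t).
Proof.
move=> h; have C0 : 0 < `|c| + 1 by rewrite ltr_wpDl.
apply: (small_variation_le C0 _ h) => u v _ _ _.
by rewrite -mulrBr normrM ler_wpM2r// lerDl.
Qed.

Lemma acM phi psi : a <= b -> ac phi -> ac psi -> ac (fun t => phi t * psi t).
Proof.
move=> ab h1 h2.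
have [B1 B10 hB1] := ac_bounded ab h1; have [B2 B20 hB2] := ac_bounded ab h2.
have C0 : 0 < B1 + B2 + 1 by rewrite ltr_wpDl// addr_ge0.
apply: (small_variation_le C0 _ (small_variationD h1 h2)) => u v au uv vb.
have -> : phi v * psi v - phi u * psi u =
    phi v * (psi v - psi u) + psi u * (phi v - phi u) by ring.
apply: (le_trans (ler_normD _ _)); rewrite !normrM mulrDr addrC lerD//.
  rewrite ler_wpM2r// (le_trans (hB2 u _ _))//; last by lra.
  exact: le_trans vb.
rewrite ler_wpM2r// (le_trans (hB1 v _ _))//; last by lra.
exact: le_trans uv.
Qed.

Lemma ac_expR (rho : R) : 0 <= rho -> ac (fun t => expR (rho * t)).
Proof.
move=> rho0; have C0 : 0 < expR (rho * b) * rho + 1.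
  by rewrite ltr_wpDl// mulr_ge0// expR_ge0.
apply: (small_variation_le C0 _ (@small_variation_len R a b)) => u v au uv vb.
have uv' : rho * u <= rho * v by rewrite ler_wpM2l.
rewrite ger0_norm ?subr_ge0 ?ler_expR//.
(* The tangent inequality 1 + x <= exp x gives the Lipschitz constant [rho * expR (rho * b)] on the
   interval. *)
have h := expR_ge1Dx (rho * u - rho * v).
have h1 : expR (rho * v) * (1 + (rho * u - rho * v)) <= expR (rho * u).
  have -> : expR (rho * u) = expR (rho * v) * expR (rho * u - rho * v).
    by rewrite -expRD addrC subrK.
  by rewrite ler_wpM2l ?expR_ge0.
have h2 : expR (rho * v) <= expR (rho * b) by rewrite ler_expR ler_wpM2l.
have h3 : expR (rho * v) * (rho * (v - u)) <= expR (rho * b) * (rho * (v - u)).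
  by rewrite ler_wpM2r// mulr_ge0// subr_ge0.
lra.
Qed.

Variable p : nat.
Implicit Types x y : R -> 'rV[R]_p.

Lemma abs_continuousE x : abs_continuous a b x =
  small_variation a b (fun u v => enorm (x v - x u)).
Proof. by []. Qed.

Lemma abs_continuousD x y : abs_continuous a b x -> abs_continuous a b y ->
  abs_continuous a b (fun t => x t + y t).
Proof.
rewrite !abs_continuousE => h1 h2.
apply: (small_variation_le ltr01 _ (small_variationD h1 h2)) => u v _ _ _.
have -> : x v + y v - (x u + y u) = (x v - x u) + (y v - y u).
  by rewrite opprD addrACA.
by rewrite mul1r ler_enormD.
Qed.

Lemma abs_continuousZ c x : abs_continuous a b x ->
  abs_continuous a b (fun t => c *: x t).
Proof.
rewrite !abs_continuousE => h; have C0 : 0 < `|c| + 1 by rewrite ltr_wpDl.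
apply: (small_variation_le C0 _ h) => u v _ _ _.
by rewrite -scalerBr enormZ ler_wpM2r ?enorm_ge0// lerDl.
Qed.

Lemma abs_continuousB x y : abs_continuous a b x -> abs_continuous a b y ->
  abs_continuous a b (fun t => x t - y t).
Proof.
move=> h1 h2; have := abs_continuousD h1 (abs_continuousZ (-1) h2).
by congr abs_continuous; apply/funext => t; rewrite scaleN1r.
Qed.

Lemma abs_continuous_cst (w : 'rV[R]_p) : abs_continuous a b (fun=> w).
Proof.
rewrite abs_continuousE; apply: (small_variation_le ltr01 _ (@small_variation0 R a b)) => u v _ _ _.
by rewrite subrr mulr0 /enorm dot0l sqrtr0.
Qed.

Lemma abs_continuous_sum n (x : 'I_n -> R -> 'rV[R]_p) :
  (forall i, abs_continuous a b (x i)) ->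
  abs_continuous a b (fun t => \sum_(i < n) x i t).
Proof.
move=> h; rewrite abs_continuousE.
apply: (small_variation_le ltr01 _ (small_variation_sum (m := fun i u v => enorm (x i v - x i u)) h)) => u v _ _ _.
rewrite mul1r -sumrB; exact: ler_enorm_sum.
Qed.

Lemma abs_continuous_mean n (x : 'I_n -> R -> 'rV[R]_p) :
  (forall i, abs_continuous a b (x i)) ->
  abs_continuous a b (fun t => mean (fun i => x i t)).
Proof. by move=> h; apply: abs_continuousZ; exact: abs_continuous_sum. Qed.

Lemma abs_continuous_le C (q : nat) (y : R -> 'rV[R]_q) x : 0 < C ->
  (forall u v, a <= u -> u <= v -> v <= b ->
     enorm (y v - y u) <= C * enorm (x v - x u)) ->
  abs_continuous a b x -> abs_continuous a b y.
Proof. by rewrite !abs_continuousE; exact: small_variation_le. Qed.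

Lemma ac_enorm x : abs_continuous a b x -> ac (fun t => enorm (x t)).
Proof.
rewrite abs_continuousE => h; apply: (small_variation_le ltr01 _ h) => u v _ _ _.
have h1 := ler_enormD (x v - x u) (x u); have h2 := ler_enormD (x u - x v) (x v).
rewrite !subrK (enormBC (x u)) in h1 h2.
by rewrite mul1r ler_norml; apply/andP; split; lra.
Qed.

Lemma ac_dot x : a <= b -> abs_continuous a b x -> ac (fun t => dot (x t) (x t)).
Proof.
move=> ab h; have := acM ab (ac_enorm h) (ac_enorm h).
by congr ac; apply/funext => t; rewrite -expr2 sqr_enorm.
Qed.

End AbsoluteContinuityClosure.

(** * Differentiation along curves *)

Section ChainRule.
Variables (R : realType) (p : nat).
Implicit Types (x : R -> 'rV[R]_p) (v w : 'rV[R]_p).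

Lemma is_derive_increment_enorm x (t : R) v : is_derive t 1 x v ->
  forall eps, 0 < eps -> exists2 d, 0 < d & forall u, `|u - t| < d ->
    enorm (x u - x t - (u - t) *: v) <= eps * `|u - t|.
Proof.
move=> dx eps eps0; have p0 : (0 : R) < p.+1%:R by rewrite ltr0n.
have [d d0 hd] := is_derive_increment dx (divr_gt0 eps0 p0).
exists d => // u /hd h; apply: (le_trans (enorm_le_normr _)).
apply: (@le_trans _ _ (p.+1%:R * (eps / p.+1%:R * `|u - t|))).
  by apply: ler_pM => //; rewrite ler_nat.
by rewrite mulrA mulrCA divff ?mulr1// gt_eqF.
Qed.

(** A chain rule that asks of [F] only an expansion at [x t] with quadratic remainder. It serves
    both for the squared norm and for the potential built from the projection. *)
Lemma is_derive_comp_quadratic (F : 'rV[R]_p -> R) x (t : R) v w (C : R) :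
  0 <= C -> is_derive t 1 x v ->
  (forall y, `|F y - F (x t) - dot w (y - x t)| <= C * dot (y - x t) (y - x t)) ->
  is_derive t 1 (fun u => F (x u)) (dot w v).
Proof.
move=> C0 dx hF; apply: increment_is_derive => eps eps0.
have w0 : 0 < enorm w + 1 by rewrite ltr_wpDl// enorm_ge0.
(* Half of [eps] goes to the expansion error of [x] paired with [w], the other half to the quadratic
   remainder, where |x u - x t| <= B |u - t|. *)
pose eps' := eps / 2 / (enorm w + 1).
have e'0 : 0 < eps' by rewrite !divr_gt0.
have [d d0 hd] := is_derive_increment_enorm dx e'0.
pose B := enorm v + eps'.
have B0 : 0 <= B by rewrite addr_ge0 ?enorm_ge0 ?(ltW e'0).
have CB0 : 0 < C * B ^+ 2 + 1 by rewrite ltr_wpDl// mulr_ge0// exprn_ge0.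
exists (Num.min d (eps / 2 / (C * B ^+ 2 + 1))).
  by rewrite lt_min d0 !divr_gt0.
move=> u; rewrite lt_min => /andP[/hd h1 h2].
set D := x u - x t in h1; set r := `|u - t| in h1 h2 *.
have r0 : 0 <= r by exact: normr_ge0.
have hD : enorm D <= B * r.
  have := ler_enormD (D - (u - t) *: v) ((u - t) *: v).
  by rewrite subrK enormZ -/r /B mulrDl; lra.
have hD2 : C * dot D D <= C * B ^+ 2 * r * r.
  have -> : C * B ^+ 2 * r * r = C * (B * r) ^+ 2 by ring.
  by rewrite -sqr_enorm ler_wpM2l// ler_pXn2r ?nnegrE ?enorm_ge0 ?mulr_ge0.
have h3 : (C * B ^+ 2 + 1) * r <= eps / 2.
  by rewrite mulrC -ler_pdivlMr// ltW.
have h4 : enorm w * eps' <= eps / 2.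
  have -> : eps / 2 = (enorm w + 1) * eps' by rewrite /eps'; field; rewrite gt_eqF.
  by rewrite ler_wpM2r ?lerDl// ltW.
have h5 := cauchy_schwarz w (D - (u - t) *: v).
have h6 : enorm w * enorm (D - (u - t) *: v) <= enorm w * (eps' * r).
  by rewrite ler_wpM2l ?enorm_ge0.
have h7 : (C * B ^+ 2 + 1) * r * r <= eps / 2 * r by rewrite ler_wpM2r.
have h8 : enorm w * eps' * r <= eps / 2 * r by rewrite ler_wpM2r.
have -> : F (x u) - F (x t) - (u - t) * dot w v =
    (F (x u) - F (x t) - dot w D) + dot w (D - (u - t) *: v).
  by rewrite dotDr dotNr dotZr; ring.
apply: (le_trans (ler_normD _ _)); have := hF (x u); rewrite -/D.
have := mulr_ge0 r0 r0; lra.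
Qed.

Lemma is_derive_dot x (t : R) v : is_derive t 1 x v ->
  is_derive t 1 (fun u => dot (x u) (x u)) (2 * dot (x t) v).
Proof.
move=> dx; rewrite -dotZl.
apply: (@is_derive_comp_quadratic (fun y => dot y y) x t v _ 1) => // y.
have -> : dot y y - dot (x t) (x t) - dot (2 *: x t) (y - x t) =
    dot (y - x t) (y - x t) by rewrite !dotE (dotC y (x t)); ring.
by rewrite mul1r ger0_norm ?dot_ge0.
Qed.

(** The substitute for a chain rule through the projection: a Lipschitz bound between the increments
    of two curves passes to their derivatives where both exist. *)
Lemma derive_enorm_le x (y : R -> 'rV[R]_p) (t : R) v w (C : R) :
  0 <= C -> is_derive t 1 x v -> is_derive t 1 y w ->
  (\forall u \near t, enorm (y u - y t) <= C * enorm (x u - x t)) ->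
  enorm w <= C * enorm v.
Proof.
move=> C0 dx dy /nbhs_ballP[d /= d0 hd].
have : enorm w - C * enorm v <= 0; last by rewrite subr_le0.
apply: (@le0_of_le_small _ _ (C + 1)) => eps eps0 _.
have [d1 d10 h1] := is_derive_increment_enorm dx eps0.
have [d2 d20 h2] := is_derive_increment_enorm dy eps0.
pose r := Num.min d (Num.min d1 d2) / 2.
have r0 : 0 < r by rewrite divr_gt0// !lt_min d0 d10.
have rm : r < Num.min d (Num.min d1 d2).
  by rewrite /r ltr_pdivrMr// ltr_pMr ?ltr1n// !lt_min d0 d10.
move: rm; rewrite !lt_min => /and3P[rd rd1 rd2].
pose u := t + r; have ut : u - t = r by rewrite /u addrAC subrr add0r.
have {}h1 := h1 u; have {}h2 := h2 u.
rewrite ut gtr0_norm// in h1 h2.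
have := h1 rd1; have := h2 rd2.
have : enorm (y u - y t) <= C * enorm (x u - x t).
  by apply: hd; rewrite -ball_normE/= distrC ut gtr0_norm.
move: (x u - x t) (y u - y t) => Dx Dy hxy hy hx.
have k1 := ler_enormD (Dx - r *: v) (r *: v).
have k2 := ler_enormB Dy (Dy - r *: w).
rewrite subKr in k2; rewrite subrK in k1.
rewrite !enormZ gtr0_norm// in k1 k2.
have k3 : C * enorm Dx <= C * (eps * r + r * enorm v).
  by rewrite ler_wpM2l//; lra.
by rewrite -(ler_pM2l r0); lra.
Qed.

End ChainRule.

(** * Rates of the Lyapunov terms *)

Section LyapunovRate.
Variables (R : realType) (N p : nat) (e : rel 'I_N).
Hypotheses (N_gt0 : (0 < N)%N) (e_sym : symmetric e).
Variables K L sig k1 k2 : R.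
Hypotheses (K_ge0 : 0 <= K) (L_gt0 : 0 < L) (sig_gt0 : 0 < sig).
Hypothesis k1_gt0 : 0 < k1.
Hypothesis poincare : forall x : 'I_N -> 'rV[R]_p,
  \sum_(i < N) dot (x i - mean x) (x i - mean x) <= K * edge_energy e x.
Hypothesis k1K : 2 * K * L ^+ 2 <= k1 * sig.

Variables eta z s g gs dg : 'I_N -> 'rV[R]_p.
Variable ss : 'rV[R]_p.
Hypothesis s_normal : forall i, dot (eta i - s i) (ss - s i) <= 0.
Hypothesis s_firm : forall i j,
  dot (s j - s i) (s j - s i) <= dot (s j - s i) (eta j - eta i).
Hypothesis s_le_eta : forall i, dot (s i - ss) (s i - ss) <=
  dot (eta i - (ss - mean gs)) (eta i - (ss - mean gs)).
Hypothesis g_mono : forall i,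
  sig * dot (s i - ss) (s i - ss) <= dot (g i - gs i) (s i - ss).
Hypothesis g_lip : forall i,
  dot (g i - gs i) (g i - gs i) <= L ^+ 2 * dot (s i - ss) (s i - ss).
Hypothesis optimal : forall i, 0 <= dot (mean gs) (s i - ss).
Hypothesis z_mean : mean z = mean g.

(** Time is frozen in this section: [eta], [z], [s], [g] are values at one instant and [dg] stands
    for the derivatives of the gradients, so all estimates are finite-dimensional algebra. *)
Definition eta_rate i : 'rV[R]_p := k1 *: laplace e eta i + (s i - eta i - z i).

Hypothesis dg_lip : forall i,
  dot (dg i) (dg i) <= L ^+ 2 * dot (eta_rate i) (eta_rate i).

Definition z_rate i : 'rV[R]_p := k2 *: laplace e z i + dg i.

Let es := ss - mean gs.
Let S2 := \sum_(i < N) dot (s i - ss) (s i - ss).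
Let D2 := \sum_(i < N) dot (s i - mean s) (s i - mean s).
Let H2 := \sum_(i < N) dot (eta i - es) (eta i - es).
Let Z2 := \sum_(i < N) dot (z i - mean z) (z i - mean z).

Let N_neq0 : (N%:R : R) != 0. Proof. by rewrite pnatr_eq0 -lt0n. Qed.
Let H2_ge0 : 0 <= H2. Proof. by apply: sumr_ge0 => i _; exact: dot_ge0. Qed.
Let Z2_ge0 : 0 <= Z2. Proof. by apply: sumr_ge0 => i _; exact: dot_ge0. Qed.

Lemma sum_mean (x : 'I_N -> 'rV[R]_p) : \sum_(i < N) x i = N%:R *: mean x.
Proof. by rewrite /mean scalerA divff// scale1r. Qed.

(** Conservation turns [mean z] into [mean g]; then the part of the sum coming from [gs],
    nonnegative by optimality, is removed. What is left splits into the strongly monotone pairing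
    and an error due to the disagreement of the [s i]. *)
Lemma sum_dot_optimal :
  \sum_(i < N) (dot (g i - gs i) (s i - ss) - dot (s i - mean s) (g i - gs i))
    <= \sum_(i < N) dot (s i - ss) (mean z).
Proof.
have E u : \sum_(i < N) dot (s i - ss) u = N%:R * dot (mean s - ss) u.
  rewrite -dot_suml sumrB sumr_const card_ord sum_mean -[ss *+ N]scaler_nat -scalerBr.
  by rewrite dotZl.
have V : 0 <= \sum_(i < N) dot (mean s - ss) (gs i).
  rewrite -dot_sumr sum_mean dotZr -E; apply: sumr_ge0 => i _.
  by rewrite dotC optimal.
have -> : \sum_(i < N) dot (s i - ss) (mean z) =
    \sum_(i < N) dot (mean s - ss) (g i).
  by rewrite E z_mean -dotZr -sum_mean dot_sumr.
rewrite -subr_ge0 -sumrB; apply: le_trans V _; apply: ler_sum => i _.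
have -> : mean s - ss = (s i - ss) - (s i - mean s).
  by apply/rowP => l; rewrite !mxE; ring.
move: (s i - ss) (s i - mean s) => u v; rewrite !dotE (dotC (g i)) (dotC (gs i)).
lra.
Qed.

(** The term [s - eta] has a good sign by the normal cone inequality. Strong monotonicity yields
    [- sig * S2], of which two Young inequalities consume a quarter each: one for the consensus
    error of [z], one for the disagreement of [s]. *)
Lemma potential_rate :
  \sum_(i < N) dot (s i - ss) (eta_rate i) <=
    - (sig / 2 * S2) + sig^-1 * Z2.
Proof.
have split i : dot (s i - ss) (eta_rate i) <=
    k1 * dot (s i) (laplace e eta i) - k1 * dot ss (laplace e eta i)
    - dot (s i - ss) (z i - mean z) - dot (s i - ss) (mean z).
  have := s_normal i; rewrite /eta_rate -(opprB (s i) ss) -(opprB (s i) (eta i)).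
  rewrite !dotE (dotC ss (s i)) (dotC (eta i)) (dotC (eta i) ss) (dotC (s i) ss).
  lra.
apply: (le_trans (ler_sum _ (fun i _ => split i))).
rewrite !sumrB -!mulr_sumr -(dot_sumr _ _ _ ss) sum_laplace// dot0r mulr0 subr0.
rewrite (sum_dot_laplace e_sym).
have h1 : D2 <= K * \sum_(i < N) \sum_(j < N)
    adj R e i j * dot (s j - s i) (eta j - eta i).
  apply: (le_trans (poincare s)).
  rewrite ler_wpM2l//; apply: ler_sum => i _; apply: ler_sum => j _.
  by rewrite ler_wpM2l ?adj_ge0.
have h2 : - \sum_(i < N) dot (s i - ss) (z i - mean z) <=
    sig / 4 * S2 + sig^-1 * Z2.
  rewrite -sumrN !mulr_sumr -big_split/=; apply: ler_sum => i _.
  have s2 : 0 < sig / 2 by rewrite divr_gt0.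
  have := dot_young (- (s i - ss)) (z i - mean z) s2.
  have -> : (sig / 2)^-1 = 2 * sig^-1 by field; rewrite gt_eqF.
  rewrite dotNl dotNl dotNr; lra.
have h3 : \sum_(i < N) dot (s i - mean s) (g i - gs i) <=
    L ^+ 2 / sig * D2 + sig / 4 * S2.
  rewrite !mulr_sumr -big_split/=; apply: ler_sum => i _.
  have a0 : 0 < 2 * L ^+ 2 / sig by rewrite divr_gt0// mulr_gt0// exprn_gt0.
  have := dot_young (s i - mean s) (g i - gs i) a0.
  have -> : (2 * L ^+ 2 / sig)^-1 = sig / (2 * L ^+ 2).
    by field; rewrite !gt_eqF.
  have : sig / (2 * L ^+ 2) * dot (g i - gs i) (g i - gs i) <=
      sig / 2 * dot (s i - ss) (s i - ss).
    have := g_lip i; set A := dot _ _; set B := dot _ _ => AB.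
    have -> : sig / 2 * B = sig / (2 * L ^+ 2) * (L ^+ 2 * B).
      by field; rewrite gt_eqF.
    by rewrite ler_pM2l// divr_gt0// mulr_gt0// exprn_gt0.
  lra.
have h4 := sum_dot_optimal; rewrite sumrB in h4.
have h5 : sig * S2 <= \sum_(i < N) dot (g i - gs i) (s i - ss).
  by rewrite mulr_sumr; apply: ler_sum.
(* The lower bound on [k1] enters here: the coupling of the [eta i] absorbs the disagreement of the
   [s i]. *)
have h6 : L ^+ 2 / sig * D2 <= k1 * (2^-1 * \sum_(i < N) \sum_(j < N)
    adj R e i j * dot (s j - s i) (eta j - eta i)).
  set Q := \sum_(i < N) _ in h1 *.
  have Q0 : 0 <= Q.
    apply: sumr_ge0 => i _; apply: sumr_ge0 => j _.
    by rewrite mulr_ge0 ?adj_ge0// (le_trans (dot_ge0 _) (s_firm i j)).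
  apply: (@le_trans _ _ (L ^+ 2 / sig * (K * Q))).
    by rewrite ler_wpM2l// divr_ge0 ?sqr_ge0// ltW.
  have : 2 * K * L ^+ 2 * Q <= k1 * sig * Q by rewrite ler_wpM2r.
  move=> h7; rewrite -(ler_pM2l sig_gt0).
  have -> : sig * (L ^+ 2 / sig * (K * Q)) = L ^+ 2 * K * Q.
    by field; rewrite gt_eqF.
  lra.
lra.
Qed.

(** The equilibrium value of z is [mean gs], while [Z2] is centred at [mean z]. The gap is the mean
    of [g - gs], which the Lipschitz bound controls by [S2]. *)
Lemma sum_sqr_deviation :
  \sum_(i < N) dot (z i - mean gs) (z i - mean gs) <= 2 * Z2 + 2 * L ^+ 2 * S2.
Proof.
have h i : dot (z i - mean gs) (z i - mean gs) <=
    2 * dot (z i - mean z) (z i - mean z) +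
    2 * dot (mean z - mean gs) (mean z - mean gs).
  have -> : z i - mean gs = (z i - mean z) + (mean z - mean gs).
    by rewrite addrA subrK.
  move: (z i - mean z) (mean z - mean gs) => u v.
  by have := dot_ge0 (u - v); rewrite !dotE (dotC v u); lra.
apply: (le_trans (ler_sum _ (fun i _ => h i))).
rewrite big_split/= -!mulr_sumr lerD2l// -mulrA ler_pM2l//.
rewrite sumr_const card_ord -[leLHS]mulr_natl.
have -> : mean z - mean gs = N%:R^-1 *: \sum_(i < N) (g i - gs i).
  by rewrite z_mean /mean -scalerBr sumrB.
have j := sqr_sum_le (fun i => g i - gs i).
rewrite dotZl dotZr mulVKf// mulrC ler_pdivrMr ?ltr0n// mulrC.
apply: (le_trans j); rewrite ler_pM2l ?ltr0n// mulr_sumr.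
exact: ler_sum.
Qed.

(** Centring at the equilibrium costs nothing, because [ss - es - mean gs] vanishes. *)
Lemma eta_rateE i : eta_rate i =
  k1 *: laplace e eta i + ((s i - ss) - (eta i - es) - (z i - mean gs)).
Proof. by rewrite /eta_rate /es; apply/rowP => l; rewrite !mxE; ring. Qed.

(** The leak [- (eta - es)] gives [- H2], and two Young inequalities spend a quarter of it each. The
    coupling is dissipative and is dropped. *)
Lemma distance_rate :
  \sum_(i < N) dot (eta i - es) (eta_rate i) <=
    - (2^-1 * H2) + (1 + 2 * L ^+ 2) * S2 + 2 * Z2.
Proof.
have h i : dot (eta i - es) (eta_rate i) <=
    k1 * dot (eta i) (laplace e eta i) - k1 * dot es (laplace e eta i)
    - 2^-1 * dot (eta i - es) (eta i - es) + dot (s i - ss) (s i - ss)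
    + dot (z i - mean gs) (z i - mean gs).
  have -> : k1 * dot (eta i) (laplace e eta i) - k1 * dot es (laplace e eta i) =
      k1 * dot (eta i - es) (laplace e eta i) by rewrite !dotE; ring.
  rewrite eta_rateE; move: (eta i - es) (s i - ss) (z i - mean gs) => u v w.
  have := dot_ge0 (u - 2 *: v); have := dot_ge0 (u + 2 *: w).
  rewrite !dotE (dotC v u) (dotC w u); lra.
apply: (le_trans (ler_sum _ (fun i _ => h i))).
rewrite !big_split/= !sumrN -!mulr_sumr -(dot_sumr _ _ _ es) sum_laplace// dot0r mulr0 subr0.
rewrite (sum_dot_laplace e_sym).
have Q0 : 0 <= k1 * edge_energy e eta by rewrite mulr_ge0 ?(ltW k1_gt0)// edge_energy_ge0.
have := sum_sqr_deviation; rewrite -/H2 -/S2 -/(edge_energy e eta).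
lra.
Qed.

Lemma sum_sqr_laplace :
  \sum_(i < N) dot (laplace e eta i) (laplace e eta i) <= 4 * N%:R ^+ 2 * H2.
Proof.
have h i : dot (laplace e eta i) (laplace e eta i) <=
    N%:R * \sum_(j < N) (2 * dot (eta j - es) (eta j - es) +
                         2 * dot (eta i - es) (eta i - es)).
  apply: (le_trans (sqr_sum_le _)); rewrite ler_pM2l ?ltr0n//.
  apply: ler_sum => j _; rewrite dotZl dotZr.
  have -> : eta j - eta i = (eta j - es) - (eta i - es).
    by apply/rowP => l; rewrite !mxE; ring.
  move: (eta j - es) (eta i - es) => u v.
  have h1 : dot (u - v) (u - v) <= 2 * dot u u + 2 * dot v v.
    by have := dot_ge0 (u + v); rewrite !dotE (dotC v u); lra.
  rewrite /adj; case: (e i j); first by rewrite !mul1r.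
  by rewrite !mul0r (le_trans (dot_ge0 _) h1).
apply: (le_trans (ler_sum _ (fun i _ => h i))).
rewrite -mulr_sumr; under eq_bigr => i _ do
  rewrite big_split/= -mulr_sumr sumr_const card_ord -[X in _ + X]mulr_natl.
rewrite big_split/= sumr_const card_ord -mulr_natl -!mulr_sumr -/H2.
by rewrite le_eqVlt; apply/orP; left; apply/eqP; ring.
Qed.

Lemma sum_sqr_eta_rate :
  \sum_(i < N) dot (eta_rate i) (eta_rate i) <=
    4 * (4 * N%:R ^+ 2 * k1 ^+ 2 + 2 + 2 * L ^+ 2) * H2 + 8 * Z2.
Proof.
have h i : dot (eta_rate i) (eta_rate i) <=
    4 * k1 ^+ 2 * dot (laplace e eta i) (laplace e eta i)
    + 4 * dot (s i - ss) (s i - ss) + 4 * dot (eta i - es) (eta i - es)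
    + 4 * dot (z i - mean gs) (z i - mean gs).
  rewrite eta_rateE.
  move: (laplace e eta i) (s i - ss) (eta i - es) (z i - mean gs) => a b c d.
  (* One square for each of the six cross terms in |k1 a + b - c - d|^2. *)
  have := dot_ge0 (k1 *: a - b); have := dot_ge0 (k1 *: a + c).
  have := dot_ge0 (k1 *: a + d); have := dot_ge0 (b + c).
  have := dot_ge0 (b + d); have := dot_ge0 (c - d).
  rewrite !dotE (dotC b a) (dotC c a) (dotC d a) (dotC c b) (dotC d b) (dotC d c).
  lra.
apply: (le_trans (ler_sum _ (fun i _ => h i))).
rewrite !big_split/= -!mulr_sumr -/S2 -/H2.
have SH : S2 <= H2 by apply: ler_sum => i _; exact: s_le_eta.
have LS : L ^+ 2 * S2 <= L ^+ 2 * H2 by rewrite ler_wpM2l ?sqr_ge0.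
have kl : k1 ^+ 2 * \sum_(i < N) dot (laplace e eta i) (laplace e eta i) <=
    k1 ^+ 2 * (4 * N%:R ^+ 2 * H2).
  by rewrite ler_wpM2l ?sqr_ge0 ?sum_sqr_laplace.
have := sum_sqr_deviation; lra.
Qed.

(** The weight [c] trades the forcing by [dg] against [Z2]: a small [c] makes the forcing harmless,
    and the resulting [c^-1 * Z2] is left to the dissipation in [k2]. A factor 2 of the Young
    inequality is given away. *)
Lemma consensus_rate c : 0 < c ->
  \sum_(i < N) dot (z i - mean z) (z_rate i) <=
    - (k2 / 2 * edge_energy e z) + c^-1 * Z2
    + c * L ^+ 2 * \sum_(i < N) dot (eta_rate i) (eta_rate i).
Proof.
move=> c0.
have h i : dot (z i - mean z) (z_rate i) <=
    k2 * dot (z i) (laplace e z i) - k2 * dot (mean z) (laplace e z i)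
    + c^-1 * dot (z i - mean z) (z i - mean z)
    + c * L ^+ 2 * dot (eta_rate i) (eta_rate i).
  have -> : k2 * dot (z i) (laplace e z i) - k2 * dot (mean z) (laplace e z i) =
      k2 * dot (z i - mean z) (laplace e z i) by rewrite !dotE; ring.
  have y := dot_young (dg i) (z i - mean z) c0.
  have gd : c * dot (dg i) (dg i) <= c * (L ^+ 2 * dot (eta_rate i) (eta_rate i)).
    by rewrite ler_pM2l.
  have p1 : 0 <= c^-1 * dot (z i - mean z) (z i - mean z).
    by rewrite mulr_ge0 ?dot_ge0// invr_ge0 ltW.
  have p2 : 0 <= c * (L ^+ 2 * dot (eta_rate i) (eta_rate i)).
    by rewrite mulr_ge0 ?(ltW c0)// mulr_ge0 ?sqr_ge0 ?dot_ge0.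
  rewrite /z_rate; move: (z i - mean z) (laplace e z i) y p1 => u v y p1.
  rewrite (dotDr (k2 *: v)) dotZr (dotC u (dg i)); lra.
apply: (le_trans (ler_sum _ (fun i _ => h i))).
rewrite !big_split/= -!mulr_sumr -/Z2.
rewrite sumrN -!mulr_sumr -(dot_sumr _ _ _ (mean z)) sum_laplace// dot0r mulr0 subr0.
rewrite (sum_dot_laplace e_sym) -/(edge_energy e z).
lra.
Qed.

(* [M] absorbs the S2-term of [distance_rate], [c] brings the contribution of
   [sum_sqr_eta_rate] to the consensus error down to H2 / 4, and the gain [k2]
   then dominates all Z2-terms. *)
Lemma lyapunov_rate (M c : R) :
  0 < c ->
  2 * (1 + 2 * L ^+ 2) = M * sig ->
  4 * c * L ^+ 2 * (4 * (4 * N%:R ^+ 2 * k1 ^+ 2 + 2 + 2 * L ^+ 2)) = 1 ->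
  2 * K * (M / sig + 3 + 8 * c * L ^+ 2 + c^-1) = k2 ->
  M * \sum_(i < N) dot (s i - ss) (eta_rate i)
  + \sum_(i < N) dot (eta i - es) (eta_rate i)
  + \sum_(i < N) dot (z i - mean z) (z_rate i) <= - (4^-1 * (H2 + Z2)).
Proof.
move=> c0 hM hc hk.
have M0 : 0 < M.
  have : 0 < M * sig by rewrite -hM mulr_gt0// ltr_wpDr// mulr_ge0// sqr_ge0.
  by rewrite pmulr_lgt0.
have h1 : M * \sum_(i < N) dot (s i - ss) (eta_rate i) <=
   M * (- (sig / 2 * S2) + sig^-1 * Z2).
  by rewrite ler_pM2l// potential_rate.
have h2 := distance_rate; have h3 := consensus_rate c0.
have h4 : c * L ^+ 2 * \sum_(i < N) dot (eta_rate i) (eta_rate i) <=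
  c * L ^+ 2 *
    (4 * (4 * N%:R ^+ 2 * k1 ^+ 2 + 2 + 2 * L ^+ 2) * H2 + 8 * Z2).
  by rewrite ler_wpM2l ?sum_sqr_eta_rate// mulr_ge0 ?sqr_ge0// ltW.
have h5 : (M / sig + 3 + 8 * c * L ^+ 2 + c^-1) * Z2 <= k2 / 2 * edge_energy e z.
  rewrite -hk; set F := _ + _ + _ + _.
  have F0 : 0 <= F.
    rewrite !addr_ge0 ?invr_ge0 ?divr_ge0 ?(ltW c0) ?(ltW M0) ?(ltW sig_gt0)//.
    by rewrite mulr_ge0 ?sqr_ge0// mulr_ge0// ltW.
  have -> : 2 * K * F / 2 * edge_energy e z = F * (K * edge_energy e z) by field.
  by rewrite ler_wpM2l// poincare.
have e1 : M * (sig / 2 * S2) = (1 + 2 * L ^+ 2) * S2.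
  by rewrite mulrA mulrA -hM; field.
have e2 : c * L ^+ 2 * (4 * (4 * N%:R ^+ 2 * k1 ^+ 2 + 2 + 2 * L ^+ 2) * H2) =
    4^-1 * H2.
  rewrite mulrA (_ : c * L ^+ 2 * _ = 4^-1)//.
  move: hc; set X := 4 * (_ + _ + _) => hc.
  have -> : c * L ^+ 2 * X = 4^-1 * (4 * c * L ^+ 2 * X) by field.
  by rewrite hc mulr1.
move: h1 h4 h5; rewrite mulrDr mulrN e1 mulrDr e2 => h1 h4 h5.
have := H2_ge0; have := Z2_ge0; lra.
Qed.

End LyapunovRate.

(** * Convergence of trajectories *)

Section ProjectionPotential.
Variables (R : realType) (p : nat) (Omega : set 'rV[R]_p).
Hypothesis Omega_convex : @convex_set R 'rV[R]_p Omega.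
Hypothesis Omega_compact : compact Omega.
Hypothesis Omega_neq0 : Omega !=set0.
Variable ss : 'rV[R]_p.
Hypothesis Omega_ss : Omega ss.
Implicit Types (x y : 'rV[R]_p).
Local Notation P := (Defs.proj Omega).

(* This convex function has gradient [P x - ss]; it vanishes on the whole normal
   cone at [ss], so it only controls the distance between projections. *)
Definition potential x : R :=
  2^-1 * (dot (x - ss) (x - ss) - dot (x - P x) (x - P x)).

(** Expanding |x - ss|^2 around [P x] leaves the left side and a cross term that [proj_normal] makes
    nonnegative. *)
Lemma potential_ge x : 2^-1 * dot (P x - ss) (P x - ss) <= potential x.
Proof.
have := proj_normal Omega_convex Omega_compact Omega_neq0 x Omega_ss.
rewrite /potential -(opprB (P x) ss).
have -> : x - ss = (x - P x) + (P x - ss) by rewrite addrA subrK.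
move: (x - P x) (P x - ss) => u v; rewrite !dotE (dotC v u); lra.
Qed.

(** The difference of the two sides is half of |(x - P x) - (es - ss)|^2 minus the inner product of
    [es - ss] with [P x - ss], which is at most 0. *)
Lemma potential_le x es : (forall v, Omega v -> dot (es - ss) (v - ss) <= 0) ->
  potential x <= 2^-1 * dot (x - es) (x - es).
Proof.
move=> /(_ (P x) (proj_in Omega_compact Omega_neq0 x)) es_normal.
move: es_normal; rewrite /potential.
have := dot_ge0 ((x - P x) - (es - ss)).
have -> : x - es = (x - P x) + (P x - ss) - (es - ss).
  by apply/rowP => i; rewrite !mxE; ring.
have -> : x - ss = (x - P x) + (P x - ss) by rewrite addrA subrK.
move: (x - P x) (P x - ss) (es - ss) => u v w.
rewrite !dotE (dotC v u) (dotC w u) (dotC w v); lra.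
Qed.

(** The potential is the maximum over v in Omega of the affine functions (|x - ss|^2 - |x - v|^2) /
    2 of x, attained at v = P x. The one that is active at [x] has slope [P x - ss] and stays below
    the potential at [y]. *)
Lemma potential_subgradient x y :
  dot (P x - ss) (y - x) <= potential y - potential x.
Proof.
have [_ /(_ _ (proj_in Omega_compact Omega_neq0 x))] :=
  proj_argmin Omega_compact Omega_neq0 y.
rewrite -[enorm (P y - y)]enormBC !sqr_enorm /potential.
have -> : P x - y = - ((x - P x) + (y - x)).
  by apply/rowP => i; rewrite !mxE; ring.
have -> : y - ss = (x - P x) + (P x - ss) + (y - x).
  by apply/rowP => i; rewrite !mxE; ring.
have -> : x - ss = (x - P x) + (P x - ss) by rewrite addrA subrK.
move: (x - P x) (P x - ss) (y - x) (y - P y) => u v w z.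
rewrite !dotE (dotC v u) (dotC w u) (dotC w v); lra.
Qed.

(** The lower bound is the subgradient inequality at [x], the upper one that at [y], whose slope
    differs by [P y - P x]. Nonexpansiveness of [P] thus replaces a second derivative. *)
Lemma potential_quadratic x y :
  `|potential y - potential x - dot (P x - ss) (y - x)| <= dot (y - x) (y - x).
Proof.
have h1 := potential_subgradient x y; have h2 := potential_subgradient y x.
have := proj_nonexpansive Omega_convex Omega_compact Omega_neq0 y x.
have := dot_le_enorm (P y - P x) (y - x).
move: h2; rewrite -(opprB y x) dotNr -[dot (y - x) (y - x)]sqr_enorm.
have -> : P y - ss = (P y - P x) + (P x - ss) by rewrite addrA subrK.
rewrite dotDl => h2 h3 h4.
have h5 : enorm (P y - P x) * enorm (y - x) <= enorm (y - x) ^+ 2.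
  by rewrite expr2 ler_wpM2r ?enorm_ge0.
move: h1 h2 h3 h5 {h4}; move: (enorm (y - x) ^+ 2) (dot (P x - ss) (y - x)).
move: (dot (P y - P x) (y - x)) (enorm (P y - P x) * enorm (y - x)) (potential y) (potential x).
by move=> a b c d r q h1 h2 h3 h5; rewrite ler_norml; apply/andP; split; lra.
Qed.

Lemma enorm_bounded : exists2 B : R, 0 < B & forall x, Omega x -> enorm (x - ss) <= B.
Proof.
have cf : {within Omega, continuous (fun x => enorm (x - ss))}.
  by apply: continuous_subspaceT => y; exact: continuous_enorm_sub.
have [c _ h] := EVT_max_rV Omega_neq0 Omega_compact cf.
exists (enorm (c - ss) + 1); first by rewrite ltr_wpDl ?enorm_ge0.
by move=> x Ox; rewrite (le_trans (h x _)) ?inE// lerDl.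
Qed.

(** The slopes [P x - ss] are bounded by compactness of [Omega], so the potential is Lipschitz. *)
Lemma ac_potential (a b : R) (x : R -> 'rV[R]_p) : abs_continuous a b x ->
  ac a b (fun t => potential (x t)).
Proof.
have [B B0 hB] := enorm_bounded; rewrite abs_continuousE => h.
apply: (small_variation_le B0 _ h) => u v _ _ _.
have hP y w : dot (P y - ss) w <= B * enorm w.
  apply: (le_trans (dot_le_enorm _ _)); rewrite ler_wpM2r ?enorm_ge0//.
  by apply: hB; exact: proj_in.
have h1 := potential_subgradient (x u) (x v).
have h2 := potential_subgradient (x v) (x u).
have h3 := hP (x v) (x v - x u); have h4 := hP (x u) (x u - x v).
rewrite -(opprB (x v)) dotNr in h2; rewrite (enormBC (x u)) -(opprB (x v)) dotNr in h4.
move: h1 h2 h3 h4; move: (dot (P (x v) - ss) (x v - x u)) (dot (P (x u) - ss) (x v - x u)).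
move: (B * enorm (x v - x u)) (potential (x v)) (potential (x u)) => a1 a2 a3 a4 a5 h1 h2 h3 h4.
by rewrite ler_norml; apply/andP; split; lra.
Qed.

Lemma is_derive_potential (x : R -> 'rV[R]_p) (t : R) v : is_derive t 1 x v ->
  is_derive t 1 (fun u => potential (x u)) (dot (P (x t) - ss) v).
Proof.
move=> dx; apply: (is_derive_comp_quadratic (C := 1)) => // y.
by rewrite mul1r; exact: potential_quadratic.
Qed.

End ProjectionPotential.

(** * Gronwall inequality for absolutely continuous functions *)

Section Decay.
Variable R : realType.
Notation mu := (@lebesgue_measure R).

Lemma ae_imply (A B : R -> Prop) : (forall t, A t -> B t) ->
  {ae mu, forall t, A t} -> {ae mu, forall t, B t}.
Proof. by move=> AB; apply: negligibleS => t nB At; apply: nB; exact: AB. Qed.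

(** Multiplication by the integrating factor [expR (rho * t)] turns the differential inequality into
    monotonicity. *)
Lemma ac_exponential_decay (T rho : R) (phi : R -> R) : 0 <= T -> 0 <= rho ->
  ac 0 T phi ->
  {ae mu, forall t : R, 0 < t -> t < T ->
     exists2 d, d <= - (rho * phi t) & is_derive t 1 phi d} ->
  phi T <= phi 0 * expR (- (rho * T)).
Proof.
move=> T0 rho0 hac hd.
have hac' : ac 0 T (fun t => phi t * expR (rho * t)).
  by apply: acM => //; exact: ac_expR.
have : phi T * expR (rho * T) <= phi 0 * expR (rho * 0).
  apply: (ac_nonincreasing T0 hac').
  apply: ae_imply hd => t hd t0 tT; have [d dle dphi] := hd t0 tT.
  have dexp : is_derive t 1 (fun u => expR (rho * u)) (rho * expR (rho * t)).
    have := @is_derive1_comp R expR (fun u => rho * u) t (expR (rho * t)) rho.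
    rewrite /comp => h; apply: is_derive_eq (h _ _) _; last by rewrite mulrC.
    - have -> : (fun u => rho * u) = rho \*: (@id R) by [].
      by apply: is_derive_eq; rewrite [_ *: _]mulr1.
  exists (phi t *: (rho * expR (rho * t)) + expR (rho * t) *: d); last exact: is_deriveM.
  rewrite /GRing.scale/=.
  have -> : phi t * (rho * expR (rho * t)) + expR (rho * t) * d =
    (rho * phi t + d) * expR (rho * t) by ring.
  by rewrite mulr_le0_ge0 ?expR_ge0//; lra.
rewrite mulr0 expR0 mulr1 expRN => h.
by rewrite ler_pdivlMr ?expR_gt0.
Qed.

End Decay.

Section Convergence.
Variables (R : realType) (N p : nat) (e : rel 'I_N).
Hypotheses (N_gt0 : (0 < N)%N) (e_sym : symmetric e).
Variable Omega : set 'rV[R]_p.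
Hypothesis Omega_convex : @convex_set R 'rV[R]_p Omega.
Hypothesis Omega_compact : compact Omega.
Hypothesis Omega_neq0 : Omega !=set0.
Variable gradf : 'I_N -> 'rV[R]_p -> 'rV[R]_p.
Variables L sig : R.
Hypotheses (L_gt0 : 0 < L) (sig_gt0 : 0 < sig).
Hypothesis grad_mono : forall i, strongly_monotone_on Omega sig (gradf i).
Hypothesis grad_lip : forall i, elipschitz_on Omega L (gradf i).
Variable ss : 'rV[R]_p.
Hypothesis Omega_ss : Omega ss.
Let gs i := gradf i ss.
Hypothesis optimal : forall v, Omega v -> 0 <= dot (mean gs) (v - ss).
Variables k1 k2 : R.
Variables eta z s : 'I_N -> R -> 'rV[R]_p.
Hypothesis traj : trajectory e Omega gradf k1 k2 1 1 eta z s.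
Local Notation P := (Defs.proj Omega).
Notation mu := (@lebesgue_measure R).

Let g i t := gradf i (s i t).
Let es := ss - mean gs.

Lemma trajectory_proj i t : 0 <= t -> s i t = P (eta i t).
Proof. by case: traj => h _ _ _; exact: h. Qed.

Lemma trajectory_in i t : 0 <= t -> Omega (s i t).
Proof. by move=> /trajectory_proj ->; exact: proj_in. Qed.

Lemma gradient_increment i u v : 0 <= u -> 0 <= v ->
  enorm (g i v - g i u) <= L * enorm (eta i v - eta i u).
Proof.
move=> u0 v0; apply: (le_trans (grad_lip _ _ _)); try exact: trajectory_in.
rewrite ler_pM2l// !trajectory_proj//; exact: proj_nonexpansive.
Qed.

Lemma eta_ac i T : 0 < T -> abs_continuous 0 T (eta i).
Proof. by case: traj => _ _ h _ T0; have [] := h i T T0. Qed.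

Lemma z_ac i T : 0 < T -> abs_continuous 0 T (z i).
Proof. by case: traj => _ _ h _ T0; have [] := h i T T0. Qed.

Lemma gradient_ac i T : 0 < T -> abs_continuous 0 T (g i).
Proof.
move=> T0; apply: (abs_continuous_le L_gt0 _ (eta_ac i T0)) => u v u0 uv _.
by apply: gradient_increment => //; exact: le_trans uv.
Qed.

Lemma trajectory_rates :
  {ae mu, forall t : R, 0 < t -> exists dg : 'I_N -> 'rV[R]_p, forall i,
     [/\ is_derive t 1 (eta i) (eta_rate e k1 (eta ^~ t) (z ^~ t) (s ^~ t) i),
         is_derive t 1 (g i) (dg i) &
         is_derive t 1 (z i) (z_rate e k2 (z ^~ t) dg i)]}.
Proof.
case: traj => _ _ _; apply: ae_imply => t h t0.
exists (fun i => 'D_1 (g i) t) => i; have [h1 [h2 h3]] := h t0 i; split.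
- apply: is_derive_eq h1 _; rewrite /eta_rate /laplace !mul1r !scale1r.
  by rewrite -!addrA.
- exact/derivableP.
- by apply: is_derive_eq h3 _; rewrite divr1.
Qed.

Lemma is_derive_mean (x : 'I_N -> R -> 'rV[R]_p) (t : R) (dx : 'I_N -> 'rV[R]_p) :
  (forall i, is_derive t 1 (x i) (dx i)) ->
  is_derive t 1 (fun u => mean (fun i => x i u)) (mean dx).
Proof.
move=> h; have -> : (fun u => mean (fun i => x i u)) = N%:R^-1 \*: \sum_(i < N) x i.
  by apply/funext => u; rewrite /mean /= fct_sumE.
exact: is_deriveZ.
Qed.

(* Summing the second equation over the agents cancels the coupling terms. *)
Lemma mean_conserved t : 0 <= t -> mean (z ^~ t) = mean (g ^~ t).
Proof.
have init : mean (z ^~ 0) = mean (g ^~ 0).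
  by rewrite /mean; congr (_ *: _); apply: eq_bigr => i _; case: traj => _ ->.
rewrite le_eqVlt => /predU1P[<-//|t0].
pose w u := mean (z ^~ u) - mean (g ^~ u).
have wac : abs_continuous 0 t w.
  by apply: abs_continuousB; apply: abs_continuous_mean => i; [exact: z_ac | exact: gradient_ac].
(* The squared norm of [w] has derivative 0 almost everywhere, so it cannot exceed its initial
   value, which is 0. *)
have : dot (w t) (w t) <= dot (w 0) (w 0).
  apply: (ac_nonincreasing (ltW t0) (ac_dot (ltW t0) wac)).
  apply: ae_imply trajectory_rates => u h u0 _; have [dg dh] := h u0.
  exists (2 * dot (w u) (mean (z_rate e k2 (z ^~ u) dg) - mean dg)); last first.
    apply: is_derive_dot.
    by apply: is_deriveB; apply: is_derive_mean => i; have [] := dh i.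
  rewrite /mean /z_rate big_split/= -scaler_sumr sum_laplace// scaler0 add0r.
  by rewrite subrr dot0r mulr0.
rewrite /w init subrr dot0l => w0; apply/subr0_eq/dot_eq0.
by apply/eqP; rewrite eq_le w0 dot_ge0.
Qed.

Variable K : R.
Hypotheses (K_ge0 : 0 <= K) (k1_gt0 : 0 < k1).
Hypothesis poincare : forall x : 'I_N -> 'rV[R]_p,
  \sum_(i < N) dot (x i - mean x) (x i - mean x) <= K * edge_energy e x.
Hypothesis k1K : 2 * K * L ^+ 2 <= k1 * sig.
Variables M c : R.
Hypothesis c_gt0 : 0 < c.
Hypothesis M_eq : 2 * (1 + 2 * L ^+ 2) = M * sig.
Hypothesis c_eq :
  4 * c * L ^+ 2 * (4 * (4 * N%:R ^+ 2 * k1 ^+ 2 + 2 + 2 * L ^+ 2)) = 1.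
Hypothesis k2_eq : 2 * K * (M / sig + 3 + 8 * c * L ^+ 2 + c^-1) = k2.

Let M_gt0 : 0 < M.
Proof.
have : 0 < M * sig by rewrite -M_eq mulr_gt0// ltr_wpDr// mulr_ge0// sqr_ge0.
by rewrite pmulr_lgt0.
Qed.

Definition lyapunov t : R :=
  M * (\sum_(i < N) potential Omega ss (eta i t)) +
  2^-1 * (\sum_(i < N) dot (eta i t - es) (eta i t - es)) +
  2^-1 * (\sum_(i < N) dot (z i t - mean (z ^~ t)) (z i t - mean (z ^~ t))).

Let es_normal v : Omega v -> dot (es - ss) (v - ss) <= 0.
Proof.
by move=> Ov; rewrite /es addrAC subrr add0r dotNl oppr_le0 optimal.
Qed.

Lemma lyapunov_ge i t : 0 <= t ->
  M * 2^-1 * dot (s i t - ss) (s i t - ss) <= lyapunov t.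
Proof.
move=> t0; rewrite /lyapunov -addrA ler_wpDr//.
  by rewrite addr_ge0// mulr_ge0// sumr_ge0// => j _; exact: dot_ge0.
have pge := potential_ge Omega_convex Omega_compact Omega_neq0 Omega_ss.
rewrite -mulrA ler_pM2l// (bigD1 i)//= ler_wpDr//.
  apply: sumr_ge0 => j _; apply: le_trans (pge _).
  by rewrite mulr_ge0// dot_ge0.
by rewrite trajectory_proj//; exact: pge.
Qed.

Lemma lyapunov_le t :
  lyapunov t <= 2^-1 * (M + 1) *
    (\sum_(i < N) dot (eta i t - es) (eta i t - es) +
     \sum_(i < N) dot (z i t - mean (z ^~ t)) (z i t - mean (z ^~ t))).
Proof.
rewrite /lyapunov; set H := \sum_(i < N) dot (eta i t - es) _; set Z := \sum_(i < N) dot (z i t - _) _.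
have Z0 : 0 <= Z by apply: sumr_ge0 => i _; exact: dot_ge0.
have h : M * (\sum_(i < N) potential Omega ss (eta i t)) <= M * (2^-1 * H).
  rewrite ler_pM2l// mulr_sumr; apply: ler_sum => i _.
  exact: potential_le.
have MZ : 0 <= M * Z by rewrite mulr_ge0// ltW.
lra.
Qed.

Lemma lyapunov_ac T : 0 < T -> ac 0 T lyapunov.
Proof.
move=> T0; have T0' := ltW T0; apply: acD; first apply: acD; apply: acZ; apply: ac_sum => i.
- by apply: ac_potential => //; exact: eta_ac.
- apply: ac_dot => //; apply: abs_continuousB; first exact: eta_ac.
  exact: abs_continuous_cst.
- apply: ac_dot => //; apply: abs_continuousB; first exact: z_ac.
  by apply: abs_continuous_mean => j; exact: z_ac.
Qed.

(** The rate arises from a derivative of at most -1/4 times the quadratic errors and a value of at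
    most (M + 1)/2 times them. *)
Lemma lyapunov_decay :
  {ae mu, forall t : R, 0 < t -> exists2 d,
     d <= - ((2 * (M + 1))^-1 * lyapunov t) & is_derive t 1 lyapunov d}.
Proof.
apply: ae_imply trajectory_rates => t h t0; have [dg dh] := h t0.
have t0' := ltW t0.
pose de := eta_rate e k1 (eta ^~ t) (z ^~ t) (s ^~ t).
pose dz := z_rate e k2 (z ^~ t) dg.
pose zm := mean (z ^~ t).
exists (M * \sum_(i < N) dot (s i t - ss) (de i)
  + 2^-1 * \sum_(i < N) (2 * dot (eta i t - es) (de i))
  + 2^-1 * \sum_(i < N) (2 * dot (z i t - zm) (dz i - mean dz))).
  have E x y : 2^-1 * \sum_(i < N) (2 * dot (x i) (y i) : R) =
      \sum_(i < N) dot (x i) (y i :> 'rV[R]_p).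
    by rewrite -mulr_sumr mulrA mulVf ?mul1r// pnatr_eq0.
  rewrite !E.
  (* The moving centre contributes nothing, since the deviations from the mean sum to zero. *)
  have -> : \sum_(i < N) dot (z i t - zm) (dz i - mean dz) =
      \sum_(i < N) dot (z i t - zm) (dz i).
    under eq_bigr => i _ do rewrite dotDr dotNr.
    by rewrite big_split/= sumrN (sum_dot_mean_center (z ^~ t))// oppr0 addr0.
  have rate : M * (\sum_(i < N) dot (s i t - ss) (de i)) +
      \sum_(i < N) dot (eta i t - es) (de i) +
      \sum_(i < N) dot (z i t - zm) (dz i) <=
      - (4^-1 * (\sum_(i < N) dot (eta i t - es) (eta i t - es) +
                 \sum_(i < N) dot (z i t - zm) (z i t - zm))).
    refine (@lyapunov_rate R N p e N_gt0 e_sym K L sig k1 k2 K_ge0 L_gt0 sig_gt0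
      k1_gt0 poincare k1K (eta ^~ t) (z ^~ t) (s ^~ t) (g ^~ t) gs dg ss
      _ _ _ _ _ _ _ _ M c c_gt0 M_eq c_eq k2_eq).
    - by move=> i; rewrite trajectory_proj//; exact: proj_normal.
    - by move=> i j; rewrite !trajectory_proj//; exact: proj_firmly_nonexpansive.
    (* Both squared distances are compared through the potential, which lies between their
       halves. *)
    - move=> i; rewrite trajectory_proj// -(ler_pM2l (_ : 0 < 2^-1))//.
      apply: (le_trans (potential_ge _ _ _ _ _)) => //.
      exact: potential_le.
    - move=> i; rewrite -sqr_enorm; apply: grad_mono => //; exact: trajectory_in.
    - move=> i; rewrite -!sqr_enorm -exprMn ler_pXn2r ?nnegrE ?mulr_ge0 ?enorm_ge0 ?(ltW L_gt0)//.
      by apply: grad_lip => //; exact: trajectory_in.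
    - by move=> i; apply: optimal; exact: trajectory_in.
    - exact: mean_conserved.
    - move=> i; rewrite -!sqr_enorm -exprMn ler_pXn2r ?nnegrE ?mulr_ge0 ?enorm_ge0 ?(ltW L_gt0)//.
      have [dei dgi _] := dh i.
      apply: (derive_enorm_le (ltW L_gt0) dei dgi).
      near=> u; apply: gradient_increment => //.
      by near: u; apply: filterS (lt_nbhsr t0) => u /ltW.
  apply: (le_trans rate); rewrite lerN2.
  have M1 : 0 < 2 * (M + 1) by rewrite mulr_gt0// addr_gt0.
  rewrite mulrC ler_pdivrMr//; apply: (le_trans (lyapunov_le t)).
  by rewrite le_eqVlt; apply/orP; left; apply/eqP; rewrite /zm; field.
have sumE (phi : 'I_N -> R -> R) (dphi : 'I_N -> R) :
    (forall i, is_derive t 1 (phi i) (dphi i)) ->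
    is_derive t 1 (fun u => \sum_(i < N) phi i u) (\sum_(i < N) dphi i).
  move=> hphi; have -> : (fun u => \sum_(i < N) phi i u) = \sum_(i < N) phi i.
    by apply/funext => u; rewrite fct_sumE.
  exact: is_derive_sum.
apply: is_deriveD; first apply: is_deriveD; apply: is_deriveZ; apply: sumE => i;
  have [dei _ dzi] := dh i.
- by rewrite trajectory_proj//; exact: is_derive_potential.
- have h1 := is_deriveB dei (is_derive_cst es t 1); rewrite subr0 in h1.
  exact: (is_derive_dot (x := fun u => eta i u - es) h1).
- apply: (is_derive_dot (x := fun u => z i u - mean (z ^~ u))).
  apply: is_deriveB => //.
  by apply: is_derive_mean => j; have [_ _] := dh j.
Unshelve. all: by end_near. Qed.

(** The Lyapunov function bounds M/2 times the squared distance, so the square root halves the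
    rate. *)
Lemma trajectory_converges i t : 0 <= t ->
  enorm (s i t - ss) <= Num.sqrt (2 * M^-1 * lyapunov 0) *
    expR (- ((4 * (M + 1))^-1 * t)).
Proof.
move=> t0; have lge := lyapunov_ge i.
have l0 : 0 <= lyapunov 0.
  by apply: le_trans (lge _ (lexx 0)); rewrite !mulr_ge0 ?dot_ge0// ltW.
have M10 : 0 < M + 1 by rewrite addr_gt0.
have lt : lyapunov t <= lyapunov 0 * expR (- ((2 * (M + 1))^-1 * t)).
  (* Absolute continuity is available on [0, T] with T positive only, so time 0 is separate. *)
  have [->|tN0] := eqVneq t 0; first by rewrite mulr0 oppr0 expR0 mulr1.
  have tgt : 0 < t by rewrite lt_neqAle eq_sym tN0.
  apply: ac_exponential_decay => //.
  - by rewrite invr_ge0 mulr_ge0// ltW.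
  - exact: lyapunov_ac.
  - by apply: ae_imply lyapunov_decay => u h u0 _; exact: h.
apply: enorm_le_dot; first by rewrite mulr_ge0 ?sqrtr_ge0 ?expR_ge0.
rewrite exprMn sqr_sqrtr ?mulr_ge0 ?invr_ge0 ?(ltW M_gt0)//.
rewrite -expRM_natl.
have -> : 2%:R * - ((4 * (M + 1))^-1 * t) = - ((2 * (M + 1))^-1 * t).
  by field; rewrite gt_eqF.
have h := le_trans (lge t t0) lt.
rewrite -(ler_pM2l (_ : 0 < M * 2^-1)) ?mulr_gt0//.
apply: (le_trans h); rewrite le_eqVlt; apply/orP; left; apply/eqP.
by field; rewrite gt_eqF.
Qed.

End Convergence.

(** * Uniqueness of the minimizer and choice of the gains *)

Lemma argmin_unique (R : realType) (N p : nat) (Omega : set 'rV[R]_p)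
    (f : 'I_N -> 'rV[R]_p -> R) (gradf : 'I_N -> 'rV[R]_p -> 'rV[R]_p) (sig : R) :
  (0 < N)%N -> @convex_set R 'rV[R]_p Omega ->
  (forall i, is_gradient_on Omega (f i) (gradf i)) ->
  0 < sig -> (forall i, strongly_monotone_on Omega sig (gradf i)) ->
  forall x y, is_argmin Omega (fun y => \sum_(i < N) f i y) x ->
    is_argmin Omega (fun y => \sum_(i < N) f i y) y -> y = x.
Proof.
move=> N0 cO fg sig0 mono x y xmin ymin.
have h := argmin_gradient cO (is_gradient_on_sum fg).
have hx := h _ xmin _ ymin.1; have hy := h _ ymin _ xmin.1.
(* Strong monotonicity summed over the agents; with the variational inequalities at [x] and [y] it
   leaves N sig |x - y|^2 <= 0. *)
have : \sum_(i < N) (sig * enorm (x - y) ^+ 2) <=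
    \sum_(i < N) dot (gradf i x - gradf i y) (x - y).
  by apply: ler_sum => i _; apply: mono; [exact: xmin.1 | exact: ymin.1].
rewrite -dot_suml sumrB dotDl dotNl sumr_const card_ord -[leLHS]mulr_natl mulrA sqr_enorm.
move: hx hy; rewrite -(opprB x y) dotNr => hx hy hxy.
have : N%:R * sig * dot (x - y) (x - y) <= 0 by lra.
rewrite pmulr_rle0 ?mulr_gt0 ?ltr0n// => xy0.
by apply/esym/subr0_eq/dot_eq0/eqP; rewrite eq_le xy0 dot_ge0.
Qed.

Theorem mainTheorem3 (R : realType) (N p : nat) (N_gt0 : (0 < N)%N)
    (e : rel 'I_N) (e_sym : symmetric e)
    (e_conn : forall i j : 'I_N, connect e i j)
    (Omega : set 'rV[R]_p)
    (Omega_convex : @convex_set R 'rV[R]_p Omega)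
    (Omega_compact : compact Omega)
    (Omega_int : interior Omega !=set0)
    (Omega_curv : bounded_normal_curvature (boundary Omega))
    (f : 'I_N -> 'rV[R]_p -> R)
    (gradf : 'I_N -> 'rV[R]_p -> 'rV[R]_p)
    (f_grad : forall i, is_gradient_on Omega (f i) (gradf i))
    (sigma L : 'I_N -> R)
    (sigma_gt0 : forall i, 0 < sigma i)
    (L_gt0 : forall i, 0 < L i)
    (f_mono : forall i, strongly_monotone_on Omega (sigma i) (gradf i))
    (f_lip : forall i, elipschitz_on Omega (L i) (gradf i)) :
  exists ystar : 'rV[R]_p,
    [/\ is_argmin Omega (fun y => \sum_(i < N) f i y) ystar,
        forall y, is_argmin Omega (fun y => \sum_(i < N) f i y) y ->
          y = ystar &
        exists k1 k2 alpha beta : R,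
          [/\ 0 < k1, 0 < k2, 0 < alpha & 0 < beta] /\
          forall eta z s : 'I_N -> R -> 'rV[R]_p,
            trajectory e Omega gradf k1 k2 alpha beta eta z s ->
            forall i, exists C rho : R,
              [/\ 0 <= C, 0 < rho &
                  forall t, 0 <= t ->
                    enorm (s i t - ystar) <= C * expR (- (rho * t))]].
Proof.
have Omega_neq0 : Omega !=set0 by case: Omega_int => x /interior_subset; exists x.
pose Lm := 1 + \sum_(i < N) L i.
have Lm_ge i : L i <= Lm.
  rewrite /Lm (bigD1 i)//= addrCA lerDl addr_ge0// sumr_ge0// => j _.
  exact: ltW.
have Lm_gt0 : 0 < Lm by rewrite ltr_wpDr// sumr_ge0// => i _; exact: ltW.
(* A common positive lower bound for the [sigma i], obtained like [Lm] from a sum instead of an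
   extremum over the agents. *)
pose sg := (1 + \sum_(i < N) (sigma i)^-1)^-1.
have sgV_gt0 : 0 < 1 + \sum_(i < N) (sigma i)^-1.
  by rewrite ltr_wpDr// sumr_ge0// => i _; rewrite invr_ge0 ltW.
have sg_gt0 : 0 < sg by rewrite invr_gt0.
have sg_le i : sg <= sigma i.
  rewrite -[leRHS]invrK lef_pV2 ?posrE ?invr_gt0//.
  rewrite (bigD1 i)//= addrCA lerDl addr_ge0// sumr_ge0// => j _.
  by rewrite invr_ge0 ltW.
have mono i : strongly_monotone_on Omega sg (gradf i).
  move=> x y Ox Oy; apply: le_trans (f_mono i x y Ox Oy).
  by rewrite ler_wpM2r ?sqr_ge0.
have lip i : elipschitz_on Omega Lm (gradf i).
  move=> x y Ox Oy; apply: (le_trans (f_lip i x y Ox Oy)).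
  by rewrite ler_wpM2r ?enorm_ge0.
have sum_grad := is_gradient_on_sum f_grad.
have [ystar ymin] := continuous_argmin Omega_compact Omega_neq0
  (is_gradient_on_continuous sum_grad).
exists ystar; split=> //.
  by move=> y; exact: (argmin_unique N_gt0 Omega_convex f_grad sg_gt0 mono ymin).
have [Oy _] := ymin.
have optimal v : Omega v -> 0 <= dot (mean (fun i => gradf i ystar)) (v - ystar).
  move=> Ov; rewrite dotZl mulr_ge0 ?invr_ge0//.
  exact: argmin_gradient sum_grad ymin _ Ov.
have [K K_gt0 poincare] := @energy_poincare R N p e e_conn.
(* [K] depends on the graph and the dimension only. Then [k1], [M], [c] and [k2] meet their side
   conditions with equality; [c] uses [k1], and [k2] comes last. *)
pose k1 := 2 * K * Lm ^+ 2 / sg.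
have k1_gt0 : 0 < k1 by rewrite divr_gt0// !mulr_gt0// exprn_gt0.
pose M := 2 * (1 + 2 * Lm ^+ 2) / sg.
have M_gt0 : 0 < M.
  by rewrite divr_gt0// mulr_gt0// ltr_wpDr// mulr_ge0// sqr_ge0.
pose X := 4 * (4 * N%:R ^+ 2 * k1 ^+ 2 + 2 + 2 * Lm ^+ 2) : R.
have X_gt0 : 0 < X.
  rewrite mulr_gt0// ltr_wpDr//; first by rewrite mulr_ge0// sqr_ge0.
  by rewrite ltr_wpDl// mulr_ge0 ?sqr_ge0// mulr_ge0// sqr_ge0.
pose c := (4 * Lm ^+ 2 * X)^-1.
have c_gt0 : 0 < c by rewrite invr_gt0 (mulr_gt0 _ X_gt0)// mulr_gt0// exprn_gt0.
pose k2 := 2 * K * (M / sg + 3 + 8 * c * Lm ^+ 2 + c^-1).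
have k2_gt0 : 0 < k2.
  have cL : 0 < c * Lm ^+ 2 by rewrite mulr_gt0// exprn_gt0.
  have MV : 0 < M / sg by rewrite divr_gt0.
  have cV : 0 < c^-1 by rewrite invr_gt0.
  by rewrite mulr_gt0 ?mulr_gt0//; lra.
have c_eq : 4 * c * Lm ^+ 2 * X = 1.
  by rewrite /c; field; rewrite !gt_eqF.
exists k1, k2, 1, 1; split=> // eta z s traj i.
(* The trajectory enters only the constant, through the initial value of the Lyapunov function; the
   rate is the same for all trajectories. *)
exists (Num.sqrt (2 * M^-1 * lyapunov Omega gradf ystar eta z M 0)), (4 * (M + 1))^-1.
split; first exact: sqrtr_ge0.
  by rewrite invr_gt0 mulr_gt0// addr_gt0.
apply: (trajectory_converges N_gt0 e_sym Omega_convex Omega_compact Omega_neq0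
  Lm_gt0 sg_gt0 mono lip Oy optimal traj (ltW K_gt0) k1_gt0 poincare
  _ c_gt0 _ c_eq) => //.
- by rewrite /k1 divfK ?gt_eqF.
- by rewrite /M divfK ?gt_eqF.
Qed.
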